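(* Let $(M,\tau)$ be a tracial $W^*$-probability space, let $X\in M$ be self-adjoint, and let $B$ be a unital $*$-subalgebra of $M$ which is algebraically free with $X$ and contains a diffuse self-adjoint element. Suppose moreover that the free Fisher information of $X$ relative to $B$ is finite: $\Phi^*(X:B)<\infty$. Then $W^*(X,B)$ is a factor.
   Context: A tracial $W^*$-probability space $(M,\tau)$ is a von Neumann algebra $M$ with a faithful normal tracial state $\tau$; $\|x\|_2=\tau(x^*x)^{1/2}$. $W^*(X,B)$ is the von Neumann subalgebra generated by $X$ and $B$, and $B\langle X\rangle$ is the algebra generated by $X$ and $B$. $B$ is algebraically free with $X$ if the natural map from the algebraic free product $B*\mathbb{C}[t]$ (amalgamated over $\mathbb C 1$) to $B\langle X\rangle$, identity on $B$ and $t\mapsto X$, is an isomorphism. A self-adjoint element is diffuse if its distribution with respect to $\tau$ has no atoms (equivalently, it has no eigenvalues). The free difference quotient relative to $B$ is the derivation $\partial_{X:B}:B\langle X\rangle\to B\langle X\rangle\otimes B\langle X\rangle$ with $\partial_{X:B}(X)=1\otimes 1$ and $\partial_{X:B}(b)=0$ for $b\in B$ (bimodule actions $a\cdot(b\otimes c)\cdot d=ab\otimes cd$). The conjugate variable of $X$ relative to $B$, if it exists, is the unique $\xi\in L^2(W^*(X,B),\tau)$ with $\tau(\xi m)=(\tau\otimes\tau)(\partial_{X:B}(m))$ for all $m\in B\langle X\rangle$; $\Phi^*(X:B)=\|\xi\|_2^2$ if $\xi$ exists, and $\infty$ otherwise. *)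

(* Defs.v *)
From HB Require Import structures.
From mathcomp Require Import all_boot all_order all_algebra generic_quotient.
From mathcomp Require Import sesquilinear complex.
From mathcomp Require Import all_classical all_reals all_analysis.

Set Implicit Arguments.
Unset Strict Implicit.
Unset Printing Implicit Defensive.

Import Order.TTheory GRing.Theory Num.Theory.
Import numFieldNormedType.Exports.
Local Open Scope classical_set_scope.
Local Open Scope complex_scope.
Local Open Scope quotient_scope.
Local Open Scope ring_scope.

Section Subalgebras.
Context {K : fieldType} {A : algType K}.

Definition subalg (S : subalgClosed A) := {x : A | x \in S}.
HB.instance Definition _ (S : subalgClosed A) := SubType.on (subalg S).
HB.instance Definition _ (S : subalgClosed A) := [Choice of subalg S by <:].
HB.instance Definition _ (S : subalgClosed A) :=
  [SubChoice_isSubAlgebra of subalg S by <:].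

Definition adjoin (B : {pred A}) (X : A) : {pred A} :=
  [pred a | `[< forall S : subalgClosed A,
                {subset B <= S} -> X \in S -> a \in S >]].

Lemma adjoin_closed (B : {pred A}) X : subalg_closed (adjoin B X).
Proof.
split=> [|a u v|u v].
- by apply/asboolP => S _ _; exact: rpred1.
- move=> /asboolP uP /asboolP vP; apply/asboolP => S BS XS.
  by apply: rpredD; [apply: rpredZ; exact: uP|exact: vP].
- move=> /asboolP uP /asboolP vP; apply/asboolP => S BS XS.
  by apply: rpredM; [exact: uP|exact: vP].
Qed.
HB.instance Definition _ (B : {pred A}) X :=
  GRing.isSubalgClosed.Build K A (adjoin B X) (adjoin_closed B X).

End Subalgebras.

Section TensorProduct.
Context {K : fieldType} (U V : lmodType K).

(* Formal sums are identified when no bilinear map tells them apart; the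
   quotient is the algebraic tensor product of U and V. *)
Definition tensor_eqv (s t : seq (U * V)) : bool :=
  `[< forall (W : lmodType K) (f : {bilinear U -> V -> W}),
      \sum_(p <- s) f p.1 p.2 = \sum_(p <- t) f p.1 p.2 >].

Lemma tensor_eqv_refl : reflexive tensor_eqv.
Proof. by move=> s; apply/asboolP. Qed.
Lemma tensor_eqv_sym : symmetric tensor_eqv.
Proof. by move=> s t; apply/asboolP/asboolP => h W f. Qed.
Lemma tensor_eqv_trans : transitive tensor_eqv.
Proof.
move=> t s u /asboolP st /asboolP tu.
by apply/asboolP => W f; rewrite st.
Qed.
Canonical tensor_equiv :=
  EquivRel tensor_eqv tensor_eqv_refl tensor_eqv_sym tensor_eqv_trans.

Definition tensor := {eq_quot tensor_equiv}.
HB.instance Definition _ := Choice.on tensor.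
HB.instance Definition _ := EqQuotient.on tensor.

Definition tens (u : U) (v : V) : tensor := \pi_tensor [:: (u, v)].

(* Independent of the representative as soon as f is bilinear, see
   tensor_liftE. *)
Definition tensor_lift {W : nmodType} (f : U -> V -> W) (t : tensor) : W :=
  \sum_(p <- repr t) f p.1 p.2.

Lemma tensorP (s t : seq (U * V)) :
  (forall (W : lmodType K) (f : {bilinear U -> V -> W}),
     \sum_(p <- s) f p.1 p.2 = \sum_(p <- t) f p.1 p.2) <->
  \pi_tensor s = \pi_tensor t.
Proof.
split=> [h|/eqmodP /asboolP //].
by apply/eqmodP; apply/asboolP.
Qed.

Lemma tensor_liftE (s : seq (U * V)) (W : lmodType K)
    (f : {bilinear U -> V -> W}) :
  tensor_lift f (\pi_tensor s) = \sum_(p <- s) f p.1 p.2.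
Proof. by have /tensorP := reprK (\pi_tensor s); apply. Qed.

Definition tensor_add (s t : tensor) : tensor := \pi_tensor (repr s ++ repr t).
Definition tensor_scale (c : K) (t : tensor) : tensor :=
  \pi_tensor [seq (c *: p.1, p.2) | p <- repr t].

Lemma tensor_liftD (W : lmodType K) (f : {bilinear U -> V -> W}) s t :
  tensor_lift f (tensor_add s t) = tensor_lift f s + tensor_lift f t.
Proof. by rewrite tensor_liftE big_cat. Qed.

Lemma tensor_liftZ (W : lmodType K) (f : {bilinear U -> V -> W}) c t :
  tensor_lift f (tensor_scale c t) = c *: tensor_lift f t.
Proof.
rewrite tensor_liftE big_map /= /tensor_lift scaler_sumr.
by apply: eq_bigr => p _; rewrite linearZl_LR.
Qed.

Lemma tensor_lift0 (W : lmodType K) (f : {bilinear U -> V -> W}) :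
  tensor_lift f (\pi_tensor [::]) = 0.
Proof. by rewrite tensor_liftE big_nil. Qed.

Lemma tensor_eqP (s t : tensor) :
  (forall (W : lmodType K) (f : {bilinear U -> V -> W}),
     tensor_lift f s = tensor_lift f t) -> s = t.
Proof. by move=> h; rewrite -[s]reprK -[t]reprK; apply/tensorP. Qed.

Lemma tensor_addA : associative tensor_add.
Proof. by move=> s t u; apply: tensor_eqP => W f; rewrite !tensor_liftD addrA. Qed.
Lemma tensor_addC : commutative tensor_add.
Proof. by move=> s t; apply: tensor_eqP => W f; rewrite !tensor_liftD addrC. Qed.
Lemma tensor_add0 : left_id (\pi_tensor [::]) tensor_add.
Proof.
by move=> s; apply: tensor_eqP => W f; rewrite !tensor_liftD tensor_lift0 add0r.
Qed.
Lemma tensor_addN :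
  left_inverse (\pi_tensor [::]) (tensor_scale (- 1)) tensor_add.
Proof.
move=> s; apply: tensor_eqP => W f.
by rewrite tensor_liftD tensor_liftZ tensor_lift0 scaleN1r addNr.
Qed.
HB.instance Definition _ := GRing.isZmodule.Build tensor
  tensor_addA tensor_addC tensor_add0 tensor_addN.

Lemma tensor_scaleA a b t :
  tensor_scale a (tensor_scale b t) = tensor_scale (a * b) t.
Proof. by apply: tensor_eqP => W f; rewrite !tensor_liftZ scalerA. Qed.
Lemma tensor_scale1 : left_id 1 tensor_scale.
Proof. by move=> s; apply: tensor_eqP => W f; rewrite tensor_liftZ scale1r. Qed.
Lemma tensor_scaleDr : right_distributive tensor_scale +%R.
Proof.
move=> c s t; apply: tensor_eqP => W f.
by rewrite !(tensor_liftZ, tensor_liftD) scalerDr.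
Qed.
Lemma tensor_scaleDl t : {morph tensor_scale^~ t : a b / a + b}.
Proof.
move=> a b; apply: tensor_eqP => W f.
by rewrite !(tensor_liftZ, tensor_liftD) scalerDl.
Qed.
HB.instance Definition _ := GRing.Zmodule_isLmodule.Build K tensor
  tensor_scaleA tensor_scale1 tensor_scaleDr tensor_scaleDl.

End TensorProduct.

Section FreeDifferenceQuotient.
Context {K : fieldType}.

Definition tensor_lact {A : algType K} (a : A) (t : tensor A A) : tensor A A :=
  tensor_lift (fun b c => tens (a * b) c) t.
Definition tensor_ract {A : algType K} (t : tensor A A) (d : A) : tensor A A :=
  tensor_lift (fun b c => tens b (c * d)) t.

(* P is the coproduct of A1 and A2 among unital algebras, i.e. their algebraic
   free product with amalgamation over the scalars. *)
Definition is_free_product (A1 A2 P : algType K)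
    (i1 : {lrmorphism A1 -> P}) (i2 : {lrmorphism A2 -> P}) : Prop :=
  forall (D : algType K) (f1 : {lrmorphism A1 -> D}) (f2 : {lrmorphism A2 -> D}),
    (exists g : {lrmorphism P -> D}, g \o i1 =1 f1 /\ g \o i2 =1 f2) /\
    (forall g h : {lrmorphism P -> D},
       g \o i1 =1 h \o i1 -> g \o i2 =1 h \o i2 -> g =1 h).

Context {A : algType K}.

Definition algebraically_free (B : subalgClosed A) (X : A) : Prop :=
  exists (P : algType K) (i : {lrmorphism subalg B -> P})
      (j : {lrmorphism {poly K} -> P}),
    is_free_product i j /\
    exists phi : {lrmorphism P -> subalg (adjoin B X)},
      [/\ forall b, val (phi (i b)) = val b, val (phi (j 'X)) = X
        & bijective phi].

Definition is_free_difference_quotient (B : {pred A}) (X : A)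
    (d : subalg (adjoin B X) -> tensor (subalg (adjoin B X)) (subalg (adjoin B X)))
    : Prop :=
  [/\ linear d,
      forall m1 m2, d (m1 * m2) = tensor_lact m1 (d m2) + tensor_ract (d m1) m2,
      forall x, val x = X -> d x = tens 1 1
    & forall b, val b \in B -> d b = 0].

Definition free_difference_quotient (B : {pred A}) (X : A) :
    subalg (adjoin B X) -> tensor (subalg (adjoin B X)) (subalg (adjoin B X)) :=
  xget (fun=> 0) [set d | is_free_difference_quotient d].

End FreeDifferenceQuotient.

(* Nonzero Hilbert spaces: the identity operator has trace 1, so the zero
   space never carries a tracial state.  The inner product is linear on the
   left. *)
HB.mixin Record isHilbert (R : realType) H of CompleteNormedModule R[i] H := {
  dotH : {dot H for Num.conj};
  normHE : forall u : H, `|u| ^+ 2 = dotH u u;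
  nontrivialH : exists u : H, u != 0 }.
#[short(type="hilbertType")]
HB.structure Definition Hilbert (R : realType) :=
  {H of CompleteNormedModule R[i] H & isHilbert R H}.

Section BoundedOperators.
Context {R : realType} {H : hilbertType R}.

Record bop := Bop {
  bop_fun :> H -> H;
  bop_linear : linear bop_fun;
  bop_continuous : continuous bop_fun }.

HB.instance Definition _ (T : bop) :=
  GRing.isLinear.Build R[i] H H *:%R (bop_fun T) (bop_linear T).

HB.instance Definition _ := gen_eqMixin bop.
HB.instance Definition _ := gen_choiceMixin bop.

Lemma bopP (S T : bop) : (forall u, S u = T u) -> S = T.
Proof.
case: S T => [f lf cf] [g lg cg] /= /funext fg; subst g.
by congr Bop; exact: Prop_irrelevance.
Qed.

Definition bop_zero : bop.
Proof.
apply: (@Bop (fun=> 0)); first by move=> a u v; rewrite scaler0 addr0.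
by move=> u; exact: cvg_cst.
Defined.

Definition bop_id : bop.
Proof. by apply: (@Bop idfun) => // u; exact: cvg_id. Defined.

Definition bop_add (S T : bop) : bop.
Proof.
apply: (@Bop (fun u => S u + T u)).
  by move=> a u v; rewrite !bop_linear scalerDr addrACA.
by move=> u; apply: cvgD; exact: bop_continuous.
Defined.

Definition bop_opp (T : bop) : bop.
Proof.
apply: (@Bop (fun u => - T u)).
  by move=> a u v; rewrite bop_linear opprD scalerN.
by move=> u; apply: cvgN; exact: bop_continuous.
Defined.

Definition bop_scale (c : R[i]) (T : bop) : bop.
Proof.
apply: (@Bop (fun u => c *: T u)).
  by move=> a u v; rewrite bop_linear scalerDr !scalerA mulrC.
by move=> u; apply: cvgZr; exact: bop_continuous.
Defined.

Definition bop_comp (S T : bop) : bop.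
Proof.
apply: (@Bop (S \o T)); first by move=> a u v; rewrite /= !bop_linear.
by move=> u; apply: continuous_comp; exact: bop_continuous.
Defined.

Fact bop_addA : associative bop_add.
Proof. by move=> S T V; apply: bopP => u; exact: addrA. Qed.
Fact bop_addC : commutative bop_add.
Proof. by move=> S T; apply: bopP => u; exact: addrC. Qed.
Fact bop_add0 : left_id bop_zero bop_add.
Proof. by move=> T; apply: bopP => u; exact: add0r. Qed.
Fact bop_addN : left_inverse bop_zero bop_opp bop_add.
Proof. by move=> T; apply: bopP => u; exact: addNr. Qed.
HB.instance Definition _ := GRing.isZmodule.Build bop
  bop_addA bop_addC bop_add0 bop_addN.

Fact bop_compA : associative bop_comp.
Proof. by move=> S T V; apply: bopP. Qed.
Fact bop_comp1 : left_id bop_id bop_comp.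
Proof. by move=> T; apply: bopP. Qed.
Fact bop_1comp : right_id bop_id bop_comp.
Proof. by move=> T; apply: bopP. Qed.
Fact bop_compDl : left_distributive bop_comp +%R.
Proof. by move=> S T V; apply: bopP. Qed.
Fact bop_compDr : right_distributive bop_comp +%R.
Proof. by move=> S T V; apply: bopP => u; exact: (linearD S). Qed.
Fact bop_id_neq0 : bop_id != 0 :> bop.
Proof.
have [u u0] := @nontrivialH R H; apply/eqP => /(congr1 (fun T : bop => T u)).
by move=> /= /eqP; rewrite (negbTE u0).
Qed.
HB.instance Definition _ := GRing.Zmodule_isNzRing.Build bop
  bop_compA bop_comp1 bop_1comp bop_compDl bop_compDr bop_id_neq0.

Fact bop_scaleA a b T : bop_scale a (bop_scale b T) = bop_scale (a * b) T.
Proof. by apply: bopP => u; exact: scalerA. Qed.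
Fact bop_scale1 : left_id 1 bop_scale.
Proof. by move=> T; apply: bopP => u; exact: scale1r. Qed.
Fact bop_scaleDr : right_distributive bop_scale +%R.
Proof. by move=> c S T; apply: bopP => u; exact: scalerDr. Qed.
Fact bop_scaleDl T : {morph bop_scale^~ T : a b / a + b}.
Proof. by move=> a b; apply: bopP => u; exact: scalerDl. Qed.
HB.instance Definition _ := GRing.Zmodule_isLmodule.Build R[i] bop
  bop_scaleA bop_scale1 bop_scaleDr bop_scaleDl.

Fact bop_scaleAl (c : R[i]) (S T : bop) : c *: (S * T) = c *: S * T.
Proof. by apply: bopP. Qed.
HB.instance Definition _ := GRing.Lmodule_isLalgebra.Build R[i] bop bop_scaleAl.

Fact bop_scaleAr (c : R[i]) (S T : bop) : c *: (S * T) = S * (c *: T).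
Proof. by apply: bopP => u; apply/esym; exact: (linearZ_LR S). Qed.
HB.instance Definition _ := GRing.Lalgebra_isAlgebra.Build R[i] bop bop_scaleAr.

(* The adjoint always exists by completeness of H, so the default is never
   used. *)
Definition adjoint (T : bop) : bop :=
  xget (0 : bop) [set S : bop | forall u v, dotH (T u) v = dotH u (S v)].

End BoundedOperators.
Arguments bop {R} H.

Section VonNeumann.
Context {R : realType} {H : hilbertType R}.
Implicit Types (M S : set (bop H)) (tau : bop H -> R[i]).

Definition commutant S : set (bop H) := [set T | forall s, S s -> T * s = s * T].

(* M'' = M makes M a unital, weakly closed algebra acting on H. *)
Definition von_neumann_algebra M : Prop :=
  (forall T, M T -> M (adjoint T)) /\ commutant (commutant M) = M.

Definition is_factor M : Prop :=
  von_neumann_algebra M /\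
  forall z, M z -> (forall y, M y -> z * y = y * z) -> exists c : R[i], z = c%:A.

Definition square_summable (xi : nat -> H) : Prop :=
  cvgn (series (fun n => `|xi n| ^+ 2 : R[i]^o)).

Definition ultraweak_functional (xi eta : nat -> H) (T : bop H) : R[i] :=
  limn (series (fun n => dotH (T (xi n)) (eta n) : R[i]^o)).

(* Continuity on M, for the topology induced by the ultraweak functionals; it
   is tested at 0, which suffices for linear functionals. *)
Definition normal_functional M tau : Prop :=
  forall e : R, 0 < e ->
  exists (d : R) (k : nat) (xi eta : 'I_k -> nat -> H),
    [/\ 0 < d, forall i, square_summable (xi i), forall i, square_summable (eta i)
      & forall T, M T ->
          (forall i, `|ultraweak_functional (xi i) (eta i) T| < d%:C) ->
          `|tau T| < e%:C].

(* Only the values of tau on M are relevant. *)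
Record tracial_Wstar_probability_space M tau : Prop := {
  tW_von_neumann : von_neumann_algebra M;
  tW_linear : forall (c : R[i]) x y, M x -> M y -> tau (c *: x + y) = c * tau x + tau y;
  tW_unital : tau 1 = 1;
  tW_positive : forall x, M x -> 0 <= tau (adjoint x * x);
  tW_faithful : forall x, M x -> tau (adjoint x * x) = 0 -> x = 0;
  tW_tracial : forall x y, M x -> M y -> tau (x * y) = tau (y * x);
  tW_normal : normal_functional M tau }.

Definition norm2 tau (x : bop H) : R := Num.sqrt (complex.Re (tau (adjoint x * x))).

Definition Wstar (X : bop H) (B : {pred bop H}) : set (bop H) :=
  [set T | forall N, von_neumann_algebra N -> N X -> (forall b, b \in B -> N b) -> N T].

(* mu is the (compactly supported) law of the self-adjoint element a *)
Definition is_distribution tau (a : bop H)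
    (mu : probability (measurableTypeR R) R) : Prop :=
  (exists r : R, mu [set x : R | - r <= x <= r] = 1%E) /\
  forall n : nat, tau (a ^+ n) = (\int[mu]_x (x ^+ n))%:C.

Definition diffuse tau (a : bop H) : Prop :=
  exists mu : probability (measurableTypeR R) R,
    is_distribution tau a mu /\ forall t : R, mu [set t] = 0%E.

(* Elements of the completion L^2(N, tau) are represented by the
   norm2-Cauchy sequences in N. *)
Definition L2 tau (N : set (bop H)) : set (nat -> bop H) :=
  [set xi | (forall n, N (xi n)) /\
     forall e : R, 0 < e -> exists k, forall m n, (k <= m)%N -> (k <= n)%N ->
       norm2 tau (xi m - xi n) < e].

Definition tau_tau tau {A : subalgClosed (bop H)}
    (t : tensor (subalg A) (subalg A)) : R[i] :=
  tensor_lift (fun a b => tau (val a) * tau (val b)) t.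

(* The left-hand side tau(xi m) is the limit of tau(xi_n m), m acting
   continuously on L^2. *)
Definition conjugate_variable tau (X : bop H) (B : {pred bop H}) :
    set (nat -> bop H) :=
  [set xi | L2 tau (Wstar X B) xi /\
     forall m : subalg (adjoin B X),
       (fun n => tau (xi n * val m) : R[i]^o) @ \oo -->
         (tau_tau tau (free_difference_quotient m) : R[i]^o)].

(* xi is unique in L^2, so that its norm does not depend on the choice made by
   xget. *)
Definition free_fisher_information tau (X : bop H) (B : {pred bop H}) : \bar R :=
  if `[< exists xi, conjugate_variable tau X B xi >] then
    let xi := xget (fun=> 0) (conjugate_variable tau X B) in
    (limn (fun n => norm2 tau (xi n) ^+ 2))%:E
  else +oo%E.

End VonNeumann.

(* Main.v *)
Require Import Defs.
From HB Require Import structures.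
From mathcomp Require Import all_boot all_order all_algebra.
From mathcomp Require Import sesquilinear complex.
From mathcomp Require Import all_classical all_reals all_analysis.
From mathcomp Require Import generic_quotient measurable_realfun ring lra.

Set Implicit Arguments.
Unset Strict Implicit.
Unset Printing Implicit Defensive.

Import Order.TTheory GRing.Theory Num.Theory.
Import numFieldNormedType.Exports.
Local Open Scope classical_set_scope.
Local Open Scope complex_scope.
Local Open Scope ring_scope.

(** Let A be the algebra generated by X and B, let d : A -> A (x) A be the free
    difference quotient, let |z| be the norm tau(z* z)^(1/2), and let Z be
    central in W*(X, B).  If Z were in A, applying d to [Z, b] = 0 for the
    diffuse element b of B would show that the tensor d Z commutes with b, and
    no nonzero square integrable tensor commutes with a diffuse element; then
    [Z, X] = 0 would give 0 = d [Z, X] = Z (x) 1 - 1 (x) Z, so that Z is a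
    scalar.  In general Z is only a limit of elements z of A for |.|, and d is
    not continuous.  The argument survives when d z is tested against the
    functionals L_(x, y) : a_1 (x) a_2 -> tau(x a_1) tau(a_2 y), x and y in A.

    - By Cauchy-Schwarz a conjugate variable makes L_(1, 1) o d continuous for
      |.| (conjugate_bound), and the Leibniz rule then makes every L_(x, y) o d
      continuous (contract_d_dominated).
    - Let S = 1 - k ad_b^2.  For small k > 0 it is a contraction for |.|
      (two_sided_diag_bump_contraction), and it fixes Z.  So z and S^n z differ
      by at most 2 |z - Z|, uniformly in n.  On the other hand
      L_(x, y)(d (S^n z)) -> 0 for z in A: since d commutes with multiplication
      by b, it is bounded by the norm of (1 - k (s - t)^2)^n in
      L^2(mu x mu), where mu is the law of b, and these functions decrease to
      the indicator function of the diagonal, a null set as mu has no atoms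
      (pairing_diag_bump_cvg0).  Hence |L_(x, y)(d z)| <= C |z - Z|
      (contract_d_near_central).
    - Applying L_(1, y) to
      d [z, X] = (d z) X - X (d z) + z (x) 1 - 1 (x) z and letting z tend to Z
      gives tau(Z) tau(y) = tau(Z y) for all y in A (trace_central), so that
      Z = tau(Z) 1 (central_scalar).

    Three facts support this.  The approximants z exist by von Neumann's density
    theorem, proved on the space of square summable sequences so that it
    controls ultraweak functionals (double_commutant_density), together with
    the normality of tau (norm2_density).  The derivation d exists because B is
    algebraically free with X: it is the second component of a homomorphism
    into the square-zero extension of A by A (x) A
    (free_difference_quotientP).  Multiplication by an element of M is
    continuous for |.| (nsq_mull); this follows from Cauchy-Schwarz and the
    operator norm continuity of tau, without square roots of operators. *)

(** * Orthogonal projections *)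

(** The form q stands for the real part of the inner product of a Hilbert space
    or of square summable sequences.  On complex subspaces, orthogonality for
    the real part and for the inner product agree. *)
Section Projection.
Context {R : realType} {V : lmodType R[i]} (q : V -> V -> R).
Hypothesis qC : forall u v, q u v = q v u.
Hypothesis qDl : forall u v w, q (u + v) w = q u w + q v w.
Hypothesis qZl : forall (t : R) u v, q (t%:C *: u) v = t * q u v.
Hypothesis q_ge0 : forall u, 0 <= q u u.
Hypothesis q_complete : forall u : nat -> V,
  (forall e : R, 0 < e -> exists N, forall m n, (N <= m)%N -> (N <= n)%N ->
     q (u m - u n) (u m - u n) < e) ->
  exists v, forall e : R, 0 < e -> exists N, forall n, (N <= n)%N ->
     q (u n - v) (u n - v) < e.

Lemma qNl u v : q (- u) v = - q u v.
Proof.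
have -> : - u = (-1)%:C *: u by rewrite rmorphN1 scaleN1r.
by rewrite qZl mulN1r.
Qed.
Lemma qNr u v : q u (- v) = - q u v.
Proof. by rewrite !(qC u) qNl. Qed.
Lemma qBl u v w : q (u - v) w = q u w - q v w.
Proof. by rewrite qDl qNl. Qed.
Lemma qBr u v w : q w (u - v) = q w u - q w v.
Proof. by rewrite !(qC w) qBl. Qed.
Lemma qDr u v w : q w (u + v) = q w u + q w v.
Proof. by rewrite !(qC w) qDl. Qed.
Lemma qZr t u v : q u (t%:C *: v) = t * q u v.
Proof. by rewrite !(qC u) qZl. Qed.
Definition qE := (qDl, qDr, qNl, qNr, qZl, qZr).

(** The values of the form at u - t v are nonnegative for all t.  When
    q v v = 0 they are affine in t, which forces q u v = 0. *)
Lemma form_CS u v : q u v ^+ 2 <= q u u * q v v.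
Proof.
have key (t : R) : 0 <= q u u - 2 * t * q u v + t ^+ 2 * q v v.
  have := q_ge0 (u - t%:C *: v); rewrite !qE (qC v u).
  move: (q u u) (q u v) (q v v) => a b c.
  by have -> : a - 2 * t * b + t ^+ 2 * c = a - t * b + (- (t * b) - t * - (t * c)) by ring.
move: key; move: (q u u) (q u v) (q v v) (q_ge0 v) => a b c c0 key.
have [c_eq0|cn0] := eqVneq c 0.
  rewrite c_eq0 mulr0; have [->|bn0] := eqVneq b 0; first by rewrite expr0n.
  have := key ((a + 1) / (2 * b)); rewrite c_eq0.
  have -> : a - 2 * ((a + 1) / (2 * b)) * b + ((a + 1) / (2 * b)) ^+ 2 * 0 = -1.
    by field.
  by rewrite lerNr oppr0 ler10.
have c_gt0 : 0 < c by rewrite lt_def cn0.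
have := key (b / c).
have -> : a - 2 * (b / c) * b + (b / c) ^+ 2 * c = (a * c - b ^+ 2) / c by field.
by rewrite pmulr_lge0 ?invr_gt0 // subr_ge0.
Qed.

(** The best approximation of a vector by a subspace exists in the closure,
    since by the parallelogram law a minimizing sequence is Cauchy; perturbing
    it along the subspace shows that the error is orthogonal. *)
Lemma orthogonal_projection (A : set V) (x : V) :
  A 0 -> (forall a b, A a -> A b -> A (a + b)) ->
  (forall (t : R) a, A a -> A (t%:C *: a)) ->
  exists p, (forall e : R, 0 < e -> exists2 a, A a & q (p - a) (p - a) < e) /\
            (forall a, A a -> q (x - p) a = 0).
Proof.
move=> A0 AD AZ.
pose E := [set q (x - a) (x - a) | a in A].
pose d : R := inf E.
pose iv (n : nat) : R := n.+1%:R^-1.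
have E_inf : has_inf E.
  split; first by exists (q (x - 0) (x - 0)); exists 0.
  by exists 0 => _ [a _ <-].
have Ed a : A a -> d <= q (x - a) (x - a).
  by move=> Aa; apply: ge_inf; [exact: E_inf.2|exists a].
have [a_ a_P] : exists a_ : nat -> V, forall n, A (a_ n) /\
    q (x - a_ n) (x - a_ n) < d + iv n.
  suff /choice[f fP] : forall n : nat, exists a, A a /\
      q (x - a) (x - a) < d + iv n by exists f.
  move=> n; have n0 : 0 < iv n by rewrite invr_gt0 ltr0Sn.
  by have [_ [a Aa <-] ad] := inf_adherent n0 E_inf; exists a.
have inv_small (e : R) : 0 < e -> exists N, forall n, (N <= n)%N -> iv n < e.
  move=> e0; exists (Num.trunc e^-1) => n Nn; rewrite /iv.
  rewrite -[ltRHS]invrK ltf_pV2 ?posrE ?invr_gt0 ?ltr0Sn //.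
  apply: lt_le_trans (truncnS_gt _) _.
  by rewrite ler_nat.
(* The parallelogram law, at the midpoint of two almost minimizing points. *)
have par m n : q (a_ m - a_ n) (a_ m - a_ n) <= (2 : R) * iv m + 2 * iv n.
  have [[Am dm] [An dn]] := (a_P m, a_P n).
  have := Ed _ (AZ 2^-1 _ (AD _ _ Am An)).
  move: dm dn; rewrite !qE.
    rewrite (qC (a_ n) (a_ m)) (qC (a_ n) x) (qC (a_ m) x).
  by lra.
have [e e0|p p_lim] := q_complete (u := a_).
  have [|N NP] := inv_small (e / 4); first lra.
  exists N => m n /NP m_small /NP n_small; apply: le_lt_trans (par m n) _.
  lra.
exists p; split=> [e e0|a Aa].
  have [N NP] := p_lim _ e0; exists (a_ N); first exact: (a_P N).1.
  have := NP N (leqnn N).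
  rewrite !qE (qC p). lra.
(* Otherwise a step of length t along a would lead below the infimum. *)
have key (t : R) : t * q (x - p) a <= t ^+ 2 * q a a.
  rewrite leNgt; apply/negP => bad.
  pose gap := t * q (x - p) a - t ^+ 2 * q a a.
  have gap0 : 0 < gap by rewrite /gap; lra.
  have [N1 NP1] := p_lim _ gap0.
  have [N2 NP2] := inv_small _ gap0.
  pose n := maxn N1 N2.
  have := NP1 n (leq_maxl _ _); have := NP2 n (leq_maxr _ _).
  have [An] := a_P n; have := Ed _ (AD _ _ An (AZ t _ Aa)).
  have := q_ge0 (a_ n - p - t%:C *: a).
  rewrite /gap !qE.
  rewrite (qC p (a_ n)) (qC (a_ n) x) (qC a x) (qC a (a_ n)) (qC a p).
  set b := a_ n; lra.
have a0 := q_ge0 a; apply/eqP/negPn/negP => h0.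
have := key (q (x - p) a / (q a a + 1)).
set h := q (x - p) a in h0 *; set c := q a a in a0 *.
have c1 : 0 < c + 1 by lra.
have -> : h / (c + 1) * h = (h / (c + 1)) ^+ 2 * (c + 1) by field; lra.
rewrite ler_pM2l; first lra.
by rewrite exprn_even_gt0 //= mulf_neq0 ?invr_eq0 // gt_eqF.
Qed.
End Projection.

Section HermitianForm.
Context {R : realType} {V : lmodType R[i]} (h : V -> V -> R[i]).
Hypothesis hC : forall u v, h v u = (h u v)^*%C.
Hypothesis hDl : forall u v w, h (u + v) w = h u w + h v w.
Hypothesis hZl : forall c u v, h (c *: u) v = c * h u v.
Hypothesis h_ge0 : forall u, 0 <= h u u.

(** The real inequality for the real part, after u is multiplied by the
    conjugate of h u v, whose phase makes h u v nonnegative. *)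
Lemma hermitian_CS u v : `|h u v| ^+ 2 <= h u u * h v v.
Proof.
have real_ge0 (z : R[i]) : 0 <= z -> z = (complex.Re z)%:C.
  by move=> /ger0_Im; case: z => a b /= ->.
pose q u v : R := complex.Re (h u v).
have hE w : h w w = (q w w)%:C by exact: real_ge0.
have q_ge0 w : 0 <= q w w by rewrite -ler0c -hE.
have [d0|d0] := eqVneq (h u v) 0.
  by rewrite d0 normr0 expr0n /= mulr_ge0.
have tE := real_ge0 _ (exprn_ge0 2 (normr_ge0 (h u v))).
set t := complex.Re _ in tE.
have t_gt0 : 0 < t by rewrite -ltcR -tE exprn_gt0 // normr_gt0.
have := @form_CS R V q _ _ _ q_ge0 ((h u v)^*%C *: u) v.
have -> : q ((h u v)^*%C *: u) v = t by rewrite /q hZl mulrC -sqr_normc.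
have -> : q ((h u v)^*%C *: u) ((h u v)^*%C *: u) = t * q u u.
  set d := _^*%C; rewrite /q hZl (hC (d *: u) u) hZl hE rmorphM /= mulrA oppr0.
  by rewrite -sqr_normc normcJ tE -rmorphM.
move=> CS; rewrite tE !hE -rmorphM lecR -(ler_pM2l t_gt0) mulrA -expr2; apply: CS.
- by move=> a b; rewrite /q (hC b); case: (h b a).
- by move=> a b c; rewrite /q hDl; case: (h a c); case: (h b c).
- by move=> r a b; rewrite /q hZl; case: (h a b) => x y /=; rewrite mul0r subr0.
Qed.
End HermitianForm.

(** * Hilbert spaces and adjoint operators *)

Section HilbertSpace.
Context {R : realType} {H : hilbertType R}.
Local Notation C := (R[i]).

Definition rdot (u v : H) : R := complex.Re (dotH u v).

Lemma dotDl (u v w : H) : dotH (u + v) w = dotH u w + dotH v w.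
Proof. exact: linearDl. Qed.
Lemma dotZl (c : C) (u v : H) : dotH (c *: u) v = c * dotH u v.
Proof. exact: linearZl_LR. Qed.
Lemma dotC (u v : H) : dotH v u = (dotH u v)^*%C.
Proof. by have := hermC (@dotH R H) v u; rewrite expr0 mul1r. Qed.
Lemma dot0l (v : H) : dotH 0 v = 0.
Proof. exact: linear0l. Qed.

Lemma dotDr (u v w : H) : dotH w (u + v) = dotH w u + dotH w v.
Proof. by rewrite !(dotC _ w) dotDl rmorphD. Qed.
Lemma dotZr (c : C) (u v : H) : dotH u (c *: v) = c^*%C * dotH u v.
Proof. by rewrite !(dotC _ u) dotZl rmorphM. Qed.

Lemma rdotC (u v : H) : rdot u v = rdot v u.
Proof. by rewrite /rdot dotC; case: (dotH v u). Qed.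
Lemma rdotDl (u v w : H) : rdot (u + v) w = rdot u w + rdot v w.
Proof. by rewrite /rdot dotDl; case: (dotH u w); case: (dotH v w). Qed.
Lemma rdotZl (t : R) (u v : H) : rdot (t%:C *: u) v = t * rdot u v.
Proof. by rewrite /rdot dotZl; case: (dotH u v) => a b /=; rewrite mul0r subr0. Qed.
Definition rdotE := qE rdotC rdotDl rdotZl.

Lemma dotHH (u : H) : dotH u u = (rdot u u)%:C.
Proof.
have := normHE u; have := exprn_ge0 2 (normr_ge0 u) => + e; rewrite e => /ger0_Im.
by rewrite /rdot; case: (dotH u u) => a b /= ->.
Qed.
Lemma rdot_ge0 (u : H) : 0 <= rdot u u.
Proof. by rewrite -ler0c -dotHH -normHE exprn_ge0. Qed.
Lemma rdot_eq0 (u : H) : rdot u u = 0 -> u = 0.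
Proof.
by move=> u0; apply/eqP; rewrite -normr_eq0 -sqrf_eq0 normHE dotHH u0.
Qed.

Lemma normH_ltP (u : H) (e : R) : 0 < e -> (`|u| < e%:C) = (rdot u u < e ^+ 2).
Proof.
move=> e0; rewrite -(ltr_pXn2r (n := 2)) ?nnegrE ?normr_ge0 ?ler0c ?ltW//.
by rewrite normHE dotHH -rmorphXn /= ltcR.
Qed.
Lemma normH_leP (u v : H) (e : R) :
  0 <= e -> (`|u| <= e%:C * `|v|) = (rdot u u <= e ^+ 2 * rdot v v).
Proof.
move=> e0; rewrite -(ler_pXn2r (n := 2)) ?nnegrE ?mulr_ge0 ?normr_ge0 ?ler0c//.
by rewrite exprMn !normHE !dotHH -rmorphXn -rmorphM /= lecR.
Qed.

Lemma bop_bounded (T : bop H) :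
  exists2 K : R, 0 < K & forall u, rdot (T u) (T u) <= K * rdot u u.
Proof.
have /linear_boundedP /pinfty_ex_gt0 [c c0 Tc] :=
  @continuous_linear_bounded _ _ _ 0 (T : {linear H -> H}) (bop_continuous (b := T) (x := 0)).
have cE : c = (complex.Re c)%:C.
  by have /ger0_Im := ltW c0; case: (c) => a b /= ->.
have K0 : 0 < complex.Re c by rewrite -ltcR -cE.
exists (complex.Re c ^+ 2); first by rewrite exprn_gt0.
by move=> u; rewrite -normH_leP ?(ltW K0)// -cE; exact: Tc.
Qed.

Lemma bounded_continuous (f : H -> H) (K : R) : linear f -> 0 <= K ->
  (forall u, rdot (f u) (f u) <= K * rdot u u) -> continuous f.
Proof.
move=> lf K0 fK.
pose F := HB.pack_for {linear H -> H} f (GRing.isLinear.Build _ _ _ _ f lf).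
apply: (@bounded_linear_continuous _ _ _ F); apply/bounded_funP => r.
exists ((Num.sqrt K)%:C * r) => u ur; apply: le_trans (_ : _ <= (Num.sqrt K)%:C * `|u|) _.
  by rewrite normH_leP ?sqrtr_ge0// sqr_sqrtr.
by rewrite ler_wpM2l // ler0c sqrtr_ge0.
Qed.

Lemma rdot_complete (u : nat -> H) :
  (forall e : R, 0 < e -> exists N, forall m n, (N <= m)%N -> (N <= n)%N ->
     rdot (u m - u n) (u m - u n) < e) ->
  exists v, forall e : R, 0 < e -> exists N, forall n, (N <= n)%N ->
     rdot (u n - v) (u n - v) < e.
Proof.
move=> uC.
have Re_gt0 (e : C) : 0 < e -> exists2 t : R, 0 < t & e = t%:C.
  move=> e0; exists (complex.Re e).
    by move: e0; case: e => a b; rewrite ltcE /= => /andP[].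
  by have /ger0_Im := ltW e0; case: (e) => a b /= ->.
have /cvg_ex [v uv] : cvgn u.
  apply/cauchy_cvgP/cauchy_ballP => _ /Re_gt0[t t0 ->]; near_simpl.
  have [N NP] := uC (t ^+ 2) (exprn_gt0 2 t0).
  exists ([set n | (N <= n)%N], [set n | (N <= n)%N]) => /=.
    by split; exists N.
  by move=> [m n] [/= Nm Nn]; rewrite -ball_normE /= normH_ltP //; exact: NP.
exists v => e e0.
have s0 : 0 < Num.sqrt e by rewrite sqrtr_gt0.
have /cvgrPdist_lt /(_ (Num.sqrt e)%:C) := uv.
rewrite ltcR => /(_ s0) [N _ NP]; exists N => n /NP.
by rewrite /= distrC normH_ltP // sqr_sqrtr // ltW.
Qed.

End HilbertSpace.

Section Adjoint.
Context {R : realType} {H : hilbertType R}.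
Local Notation C := (R[i]).
Implicit Types (S T : bop H) (u v : H).

Lemma dot_ext (v w : H) : (forall u, dotH u v = dotH u w) -> v = w.
Proof.
move=> vw; apply/eqP; rewrite -subr_eq0; apply/eqP/rdot_eq0.
by rewrite /rdot dotDr vw -scaleN1r dotZr rmorphN1 mulN1r subrr.
Qed.

(** Riesz representation: off the kernel of f, the component of a vector
    orthogonal to the kernel is, up to a factor, the representing vector. *)
Lemma riesz (f : H -> C) (K : R) : linear_for *%R f ->
  (forall u, `|f u| ^+ 2 <= (K * rdot u u)%:C) -> exists v, forall u, f u = dotH u v.
Proof.
move=> lf fK.
have fD u w : f (u + w) = f u + f w by rewrite -[u in LHS]scale1r lf mul1r.
have f0 : f 0 = 0 by apply: (addrI (f 0)); rewrite -fD !addr0.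
have fZ c u : f (c *: u) = c * f u by rewrite -[_ *: _]addr0 lf f0 addr0.
have [fall0|/existsNP[x /eqP fx]] := pselect (forall u, f u = 0).
  by exists 0 => u; rewrite fall0 dotC dot0l rmorph0.
have [] := @orthogonal_projection R H rdot rdotC rdotDl rdotZl rdot_ge0
  (@rdot_complete R H) [set u | f u = 0] x.
- exact: f0.
- by move=> a b /= fa fb; rewrite fD fa fb addr0.
- by move=> t a /= fa; rewrite fZ fa mulr0.
move=> p [p_cl p_orth].
have fp : f p = 0.
  apply/eqP; rewrite -normr_eq0 -sqrf_eq0; apply/eqP.
  have : `|f p| ^+ 2 = (complex.Re (`|f p| ^+ 2))%:C.
    by have /ger0_Im := exprn_ge0 2 (normr_ge0 (f p)); case: (`|f p| ^+ 2) => a b /= ->.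
  set t := complex.Re _ => tE; rewrite tE; apply/eqP; rewrite eq_complex /= eqxx andbT.
  have t0 : 0 <= t by rewrite -ler0c -tE exprn_ge0.
  apply/negPn/negP => tn0.
  have t_gt0 : 0 < t by rewrite lt_def tn0.
  have K1 : 0 < `|K| + 1 by rewrite ltr_wpDl.
  have [a fa pa] := p_cl (t / (`|K| + 1)) (divr_gt0 t_gt0 K1).
  have := fK (p - a); rewrite -scaleN1r fD fZ fa mulr0 addr0 tE lecR scaleN1r.
  rewrite leNgt => /negP; apply.
  apply: le_lt_trans (_ : _ <= (`|K| + 1) * rdot (p - a) (p - a)) _.
    rewrite ler_wpM2r ?rdot_ge0 //; apply: le_trans (ler_norm _) _.
    by rewrite lerDl ler01.
  by rewrite mulrC -ltr_pdivlMr.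
pose w := x - p.
have fw : f w = f x by rewrite /w -scaleN1r fD fZ fp mulr0 addr0.
have w_orth a : f a = 0 -> dotH a w = 0.
  move=> fa; apply/eqP; rewrite eq_complex /=; apply/andP; split; apply/eqP.
    by have := p_orth _ fa; rewrite rdotC.
  have := p_orth ('i%C *: a); rewrite /= fZ fa mulr0 rdotC => /(_ erefl).
  rewrite /rdot dotZl -/w; case: (dotH a w) => r s /=.
  by rewrite mul0r mul1r sub0r => /eqP; rewrite oppr_eq0 => /eqP.
have w0 : dotH w w != 0.
  apply/eqP => ww; move: fx; rewrite -fw.
  have -> : w = 0 by apply: rdot_eq0; rewrite /rdot ww.
  by rewrite f0 eqxx.
exists ((f w / dotH w w)^*%C *: w) => u.
rewrite dotZr conjcK.
have : dotH (u - (f u / f w) *: w) w = 0.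
  apply: w_orth; rewrite -scaleN1r fD !fZ mulfVK ?mulN1r ?subrr //.
  by rewrite fw.
rewrite -scaleN1r scalerA dotDl dotZl mulN1r mulNr => /eqP; rewrite subr_eq0 => /eqP ->.
by rewrite fw; field; rewrite fx w0.
Qed.

Lemma rdot_CS u v : rdot u v ^+ 2 <= rdot u u * rdot v v.
Proof. exact: (form_CS rdotC rdotDl rdotZl rdot_ge0). Qed.

Lemma dot_CS u v : `|dotH u v| ^+ 2 <= (rdot u u * rdot v v)%:C.
Proof.
rewrite rmorphM /= -!dotHH; apply: (hermitian_CS (h := @dotH R H)).
- by move=> a b; exact: dotC.
- exact: dotDl.
- exact: dotZl.
- by move=> w; rewrite dotHH ler0c rdot_ge0.
Qed.

Lemma adjoint_exists T : exists S : bop H, forall u v, dotH (T u) v = dotH u (S v).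
Proof.
have [K K0 TK] := bop_bounded T.
have /choice[f fP] : forall v, exists w, forall u, dotH (T u) v = dotH u w.
  move=> v; apply: (@riesz _ (K * rdot v v)) => [c u w|u].
    by rewrite linearP dotDl dotZl.
  apply: le_trans (dot_CS _ _) _; rewrite lecR mulrAC.
  by rewrite ler_wpM2r ?rdot_ge0.
have lf : linear f.
  move=> c u v; apply: dot_ext => w.
  by rewrite -fP !(dotDr, dotZr) !fP.
have bf u : rdot (f u) (f u) <= K * rdot u u.
  have [->|fu] := eqVneq (rdot (f u) (f u)) 0; first by rewrite mulr_ge0 ?rdot_ge0 // ltW.
  have fu0 : 0 < rdot (f u) (f u) by rewrite lt_def fu rdot_ge0.
  have := rdot_CS (T (f u)) u; rewrite {1}/rdot fP -/(rdot _ _) => h.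
  rewrite -(ler_pM2l fu0) -expr2; apply: le_trans h _.
  by rewrite mulrA [_ * K]mulrC ler_wpM2r ?rdot_ge0.
by exists (Bop lf (bounded_continuous lf (ltW K0) bf)).
Qed.

Lemma adjointP T u v : dotH (T u) v = dotH u (adjoint T v).
Proof. by rewrite /adjoint; case: xgetP => [S _ ->//|no]; have [S /no] := adjoint_exists T. Qed.

Lemma adjointPr T u v : dotH u (T v) = dotH (adjoint T u) v.
Proof. by rewrite dotC adjointP -dotC. Qed.

Lemma rdot_adjoint T u v : rdot (T u) v = rdot u (adjoint T v).
Proof. by rewrite /rdot adjointP. Qed.

Lemma adjoint_uniq T S : (forall u v, dotH (T u) v = dotH u (S v)) -> adjoint T = S.
Proof. by move=> TS; apply: bopP => v; apply: dot_ext => u; rewrite -adjointP TS. Qed.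

Lemma adjointK : involutive (@adjoint R H).
Proof. by move=> T; apply: adjoint_uniq => u v; rewrite adjointPr. Qed.

Lemma adjointM S T : adjoint (S * T) = adjoint T * adjoint S.
Proof. by apply: adjoint_uniq => u v; rewrite /= !adjointP. Qed.

Lemma adjoint1 : adjoint (1 : bop H) = 1.
Proof. exact: adjoint_uniq. Qed.

Lemma adjointD S T : adjoint (S + T) = adjoint S + adjoint T.
Proof. by apply: adjoint_uniq => u v; rewrite /= dotDl dotDr !adjointP. Qed.

Lemma adjointZ (c : C) T : adjoint (c *: T) = c^*%C *: adjoint T.
Proof. by apply: adjoint_uniq => u v; rewrite /= dotZl dotZr conjcK adjointP. Qed.

End Adjoint.

(** * Square summable sequences *)

Section SquareSummable.
Context {R : realType} {H : hilbertType R}.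
Local Notation C := (R[i]).
Implicit Types (u v : nat -> H) (T : bop H).

Definition partial_dot n u v : R := \sum_(i < n) rdot (u i) (v i).

Lemma partial_dotC n u v : partial_dot n u v = partial_dot n v u.
Proof. by apply: eq_bigr => i _; rewrite rdotC. Qed.
Lemma partial_dotDl n u v w :
  partial_dot n (u + v) w = partial_dot n u w + partial_dot n v w.
Proof. by rewrite -big_split; apply: eq_bigr => i _; exact: rdotDl. Qed.
Lemma partial_dotZl n (t : R) u v : partial_dot n (t%:C *: u) v = t * partial_dot n u v.
Proof. by rewrite /partial_dot mulr_sumr; apply: eq_bigr => i _; exact: rdotZl. Qed.
Lemma partial_dot_ge0 n u : 0 <= partial_dot n u u.
Proof. by apply: sumr_ge0 => i _; exact: rdot_ge0. Qed.
Lemma partial_dot_le m n u : (m <= n)%N -> partial_dot m u u <= partial_dot n u u.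
Proof.
move=> mn; rewrite /partial_dot -!(big_mkord xpredT (fun i => rdot (u i) (u i))).
rewrite (big_cat_nat (leq0n m) mn) /= lerDl.
by apply: sumr_ge0 => i _; exact: rdot_ge0.
Qed.
Definition partial_dotE n := qE (@partial_dotC n) (@partial_dotDl n) (@partial_dotZl n).

Definition square_sum_bounded u := exists K : R, forall n, partial_dot n u u <= K.

Lemma square_sum_boundedD u v :
  square_sum_bounded u -> square_sum_bounded v -> square_sum_bounded (u + v).
Proof.
move=> [K uK] [L vL]; exists (2 * K + 2 * L) => n.
have := partial_dot_ge0 n (u - v); have := uK n; have := vL n.
rewrite !partial_dotE (partial_dotC _ v u).
by move: (partial_dot n u u) (partial_dot n v v) (partial_dot n u v) => a b c; lra.
Qed.

Lemma square_sum_bounded_map T u :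
  square_sum_bounded u -> square_sum_bounded (fun i => T (u i)).
Proof.
move=> [K uK]; have [L L0 TL] := bop_bounded T; exists (L * K) => n.
apply: le_trans (_ : _ <= L * partial_dot n u u) _; last by rewrite ler_pM2l.
by rewrite /partial_dot mulr_sumr; apply: ler_sum => i _.
Qed.

Definition ell2_pred : {pred nat -> H} := [pred u | `[< square_sum_bounded u >]].

Lemma ell2_submod_closed : submod_closed ell2_pred.
Proof.
split=> [|c u v /asboolP uP /asboolP vP].
  apply/asboolP; exists 0 => n; rewrite /partial_dot big1 // => i _.
  by rewrite /rdot dot0l.
apply/asboolP/square_sum_boundedD => //.
have := square_sum_bounded_map (c%:A : bop H) uP; congr square_sum_bounded.
Qed.
HB.instance Definition _ :=
  GRing.isSubmodClosed.Build C (nat -> H) ell2_pred ell2_submod_closed.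

Record ell2 := Ell2 { ell2_val :> nat -> H; ell2P : ell2_val \in ell2_pred }.
HB.instance Definition _ := [isSub for ell2_val].
HB.instance Definition _ := [Choice of ell2 by <:].
HB.instance Definition _ := [SubChoice_isSubLmodule of ell2 by <:].

Lemma ell2_valD (u v : ell2) : ell2_val (u + v) = ell2_val u + ell2_val v.
Proof. by []. Qed.

(** Only the real part of the inner product: its series converges since, by
    polarization, it is a combination of bounded monotone ones. *)
Definition ell2_dot (u v : ell2) : R := limn (fun n => partial_dot n u v).

Lemma ell2_dot_sqr_cvg (u : ell2) :
  cvgn (fun n => partial_dot n u u) /\ forall n, partial_dot n u u <= ell2_dot u u.
Proof.
have /asboolP[K uK] := ell2P u.
have nd : nondecreasing_seq (fun n => partial_dot n u u).
  by move=> m n; exact: partial_dot_le.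
have cv : cvgn (fun n => partial_dot n u u).
  by apply: nondecreasing_is_cvgn => //; exists K => _ [n _ <-].
by split=> // n; exact: nondecreasing_cvgn_le.
Qed.

Lemma ell2_dot_cvg (u v : ell2) : (fun n => partial_dot n u v) @ \oo --> ell2_dot u v.
Proof.
suff: cvgn (fun n => partial_dot n u v) by [].
have -> : (fun n => partial_dot n u v) = (fun n => 2^-1 *
    (partial_dot n (u + v : ell2) (u + v : ell2) - partial_dot n u u - partial_dot n v v)).
  apply/funext => n; rewrite ell2_valD !partial_dotE (partial_dotC n v u).
  by move: (partial_dot n u u) (partial_dot n v v) (partial_dot n u v) => a b c; lra.
apply: is_cvgMr; apply: is_cvgB; first apply: is_cvgB;
  exact: (ell2_dot_sqr_cvg _).1.
Qed.

Lemma ell2_dotC (u v : ell2) : ell2_dot u v = ell2_dot v u.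
Proof. by congr (lim _); congr (_ @ \oo); apply/funext => n; exact: partial_dotC. Qed.
Lemma ell2_dotDl (u v w : ell2) : ell2_dot (u + v) w = ell2_dot u w + ell2_dot v w.
Proof.
apply/cvg_lim => //.
rewrite (_ : (fun n => _) = (fun n => partial_dot n u w) \+ (fun n => partial_dot n v w)).
  by apply: cvgD; exact: ell2_dot_cvg.
by apply/funext => n; exact: partial_dotDl.
Qed.
Lemma ell2_dotZl (t : R) (u v : ell2) : ell2_dot (t%:C *: u) v = t * ell2_dot u v.
Proof.
apply/cvg_lim => //; rewrite (_ : (fun n => _) = (fun n => t * partial_dot n u v)).
  by apply: cvgMr; exact: ell2_dot_cvg.
by apply/funext => n; exact: partial_dotZl.
Qed.
Lemma ell2_dot_ge0 (u : ell2) : 0 <= ell2_dot u u.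
Proof. exact: le_trans (partial_dot_ge0 0 u) ((ell2_dot_sqr_cvg u).2 0%N). Qed.
Lemma ell2_dot_le (u : ell2) (K : R) :
  (forall n, partial_dot n u u <= K) -> ell2_dot u u <= K.
Proof.
move=> uK; apply: limr_le; first exact: (ell2_dot_sqr_cvg u).1.
by near=> n; exact: uK.
Unshelve. all: by end_near. Qed.
Lemma ell2_coord_le (u : ell2) i : rdot (u i) (u i) <= ell2_dot u u.
Proof.
apply: le_trans ((ell2_dot_sqr_cvg u).2 i.+1).
by rewrite /partial_dot big_ord_recr /= lerDr; exact: partial_dot_ge0.
Qed.

Definition ell2E := qE ell2_dotC ell2_dotDl ell2_dotZl.

End SquareSummable.

Section Ell2Complete.
Context {R : realType} {H : hilbertType R}.
Local Notation ell2 := (@ell2 R H).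

(** The coordinatewise limit is the limit, because the bounds on the partial
    sums of squares do not depend on their length. *)
Lemma ell2_complete (u : nat -> ell2) :
  (forall e : R, 0 < e -> exists N, forall m n, (N <= m)%N -> (N <= n)%N ->
     ell2_dot (u m - u n) (u m - u n) < e) ->
  exists v, forall e : R, 0 < e -> exists N, forall n, (N <= n)%N ->
     ell2_dot (u n - v) (u n - v) < e.
Proof.
move=> uC.
have /choice[v vP] : forall i, exists w : H, forall e : R, 0 < e -> exists N, forall n,
    (N <= n)%N -> rdot (u n i - w) (u n i - w) < e.
  move=> i; apply: (@rdot_complete _ _ (fun n => u n i)) => e e0.
  have [N NP] := uC e e0; exists N => m n Nm Nn.
  by apply: le_lt_trans (NP m n Nm Nn); exact: (ell2_coord_le (u m - u n)).
have tail (e : R) : 0 < e -> exists N, forall m, (N <= m)%N -> forall k,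
    partial_dot k ((u m : nat -> H) - v) ((u m : nat -> H) - v) <= e.
  move=> e0; have [|N NP] := uC (e / 4); first lra.
  exists N => m Nm k.
  pose d : R := e / (4 * k.+1%:R).
  have k0 : 0 < k.+1%:R :> R by rewrite ltr0Sn.
  have d0 : 0 < d by rewrite divr_gt0 ?mulr_gt0.
  have /choice[Ni NiP] : forall i, exists M, forall n, (M <= n)%N ->
    rdot (u n i - v i) (u n i - v i) < d by move=> i; exact: vP.
  pose n := maxn N (\max_(i < k) Ni i).
  have coord (i : 'I_k) : rdot (u m i - v i) (u m i - v i) <=
      2 * rdot ((u m - u n) i) ((u m - u n) i) + 2 * d.
    have lt_d : rdot (u n i - v i) (u n i - v i) < d.
      apply: NiP; apply: leq_trans (leq_maxr _ _).
      exact: (@leq_bigmax _ (fun j : 'I_k => Ni j) i).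
    have -> : (u m - u n) i = u m i - u n i by [].
    have := rdot_ge0 ((u m i - u n i) - (u n i - v i)).
    have -> : u m i - v i = (u m i - u n i) + (u n i - v i).
      by rewrite addrA subrK.
    move: (u m i - u n i) (u n i - v i) lt_d => x y.
    rewrite !rdotE (rdotC y x).
    by move: (rdot x x) (rdot x y) (rdot y y) => a b c; lra.
  apply: le_trans (ler_sum _ (fun i _ => coord i)) _.
  rewrite big_split /= -mulr_sumr sumr_const card_ord.
  have : partial_dot k (u m - u n : ell2) (u m - u n : ell2) < e / 4.
    by apply: le_lt_trans ((ell2_dot_sqr_cvg _).2 k) (NP m n Nm _); rewrite leq_maxl.
  rewrite -/(partial_dot k (u m - u n : ell2) (u m - u n : ell2)).
  move: (partial_dot k _ _) => s s_lt.
  have kd : (2 * d) *+ k <= e / 2.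
    rewrite -[(2 * d) *+ k]mulr_natr.
    have -> : e / 2 = 2 * d * k.+1%:R by rewrite /d; field; lra.
    by rewrite ler_pM2l ?ler_nat // mulr_gt0.
  by move: ((2 * d) *+ k) kd => r; lra.
have v_ell2 : v \in ell2_pred.
  have [N /(_ N (leqnn N)) NP] := tail 1 ltr01.
  have -> : v = (u N : nat -> H) - ((u N : nat -> H) - v) by rewrite subKr.
  rewrite rpredB ?ell2P //; apply/asboolP; by exists 1.
exists (Ell2 v_ell2) => e e0; have [|N NP] := tail (e / 2); first lra.
exists N => n Nn; apply: (@le_lt_trans _ _ (e / 2)); last lra.
by apply: ell2_dot_le => k; exact: NP.
Qed.

Definition single (m : nat) (h : H) : nat -> H := fun i => if i == m then h else 0.

Lemma partial_dot_single (u : nat -> H) m h n :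
  partial_dot n u (single m h) = if (m < n)%N then rdot (u m) h else 0.
Proof.
have r0 w : rdot w 0 = 0 by rewrite /rdot dotC dot0l conjc0.
elim: n => [|n IHn]; first by rewrite /partial_dot big_ord0.
rewrite /partial_dot big_ord_recr /= -/(partial_dot n u (single m h)) IHn /single ltnS.
have [->|mn] := eqVneq n m; first by rewrite ltnn leqnn add0r.
by rewrite r0 addr0 ltn_neqAle eq_sym mn.
Qed.

Lemma single_ell2 m h : single m h \in ell2_pred.
Proof.
apply/asboolP; exists (rdot h h) => n; rewrite partial_dot_single /single eqxx.
by case: ifP => // _; exact: rdot_ge0.
Qed.
Definition ell2_single m h : ell2 := Ell2 (single_ell2 m h).

Lemma ell2_dot_single (u : ell2) m h : ell2_dot u (ell2_single m h) = rdot (u m) h.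
Proof.
apply/cvg_lim => //; apply/cvgrPdist_lt => e e0; exists m.+1 => // n /= mn.
by rewrite partial_dot_single mn subrr normr0.
Qed.

Lemma ell2_map_proof (T : bop H) (u : ell2) : (fun i => T (u i)) \in ell2_pred.
Proof. by apply/asboolP/square_sum_bounded_map; have /asboolP := ell2P u. Qed.
Definition ell2_map (T : bop H) (u : ell2) : ell2 := Ell2 (ell2_map_proof T u).

Lemma ell2_ext (u v : ell2) : (forall i, u i = v i) -> u = v.
Proof. by move=> uv; apply: val_inj; apply/funext. Qed.

Lemma ell2_dot_eq0 (u : ell2) : ell2_dot u u = 0 -> u = 0.
Proof.
move=> u0; apply: ell2_ext => i; apply: rdot_eq0; apply/eqP.
by rewrite eq_le rdot_ge0 andbT -u0 ell2_coord_le.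
Qed.

Lemma ell2_map_adjoint T (u v : ell2) :
  ell2_dot (ell2_map T u) v = ell2_dot u (ell2_map (adjoint T) v).
Proof.
congr (lim _); congr (_ @ \oo); apply/funext => n.
by apply: eq_bigr => i _; exact: rdot_adjoint.
Qed.

Lemma ell2_map_bounded T : exists2 K : R, 0 < K &
  forall u, ell2_dot (ell2_map T u) (ell2_map T u) <= K * ell2_dot u u.
Proof.
have [K K0 TK] := bop_bounded T; exists K => // u; apply: ell2_dot_le => n.
apply: le_trans (_ : _ <= K * partial_dot n u u) _.
  by rewrite /partial_dot mulr_sumr; apply: ler_sum => i _; exact: TK.
by rewrite ler_pM2l //; exact: (ell2_dot_sqr_cvg u).2.
Qed.

Lemma ell2_mapB T (u v : ell2) : ell2_map T (u - v) = ell2_map T u - ell2_map T v.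
Proof. by apply: ell2_ext => i; exact: (linearB T). Qed.

End Ell2Complete.

(** * Density in the double commutant *)

Section Commutants.
Context {R : realType} {H : hilbertType R}.
Implicit Types (A M N : set (bop H)).

Definition adjoint_closed A := forall a, A a -> A (adjoint a).

Lemma commutant_adjoint A : adjoint_closed A -> adjoint_closed (commutant A).
Proof.
move=> Aadj T AT a Aa; rewrite -[a]adjointK -!adjointM.
by rewrite (AT _ (Aadj _ Aa)).
Qed.

Lemma commutant_anti A M : A `<=` M -> commutant M `<=` commutant A.
Proof. by move=> AM T MT a /AM /MT. Qed.

Lemma double_commutant_sup A : A `<=` commutant (commutant A).
Proof. by move=> a Aa T AT; rewrite AT. Qed.

Lemma double_commutant_von_neumann A :
  adjoint_closed A -> von_neumann_algebra (commutant (commutant A)).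
Proof.
move=> Aadj; split; first by do 2!apply: commutant_adjoint.
apply/seteqP; split; last exact: double_commutant_sup.
by apply: commutant_anti; exact: double_commutant_sup.
Qed.

End Commutants.

Section Density.
Context {R : realType} {H : hilbertType R}.
Local Notation ell2 := (@ell2 R H).
Variable A : set (bop H).
Hypothesis A1 : A 1.
Hypothesis AD : forall a b, A a -> A b -> A (a + b).
Hypothesis AZ : forall (c : R[i]) a, A a -> A (c *: a).
Hypothesis AM : forall a b, A a -> A b -> A (a * b).
Hypothesis Aadj : adjoint_closed A.

(** Von Neumann's density theorem for a sequence of vectors.  The projection
    onto the closure of the orbit of zeta under A commutes with the diagonal
    action of A, so that its matrix entries p n m lie in the commutant of A and
    commute with T and its adjoint.  It therefore commutes with the diagonal
    action of T, and fixes T zeta because it fixes zeta. *)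
Lemma double_commutant_density (T : bop H) (zeta : ell2) (e : R) :
  commutant (commutant A) T -> 0 < e ->
  exists2 a, A a & forall n,
    \sum_(i < n) rdot ((T - a) (zeta i)) ((T - a) (zeta i)) < e.
Proof.
move=> TA e0.
pose K := [set ell2_map a zeta | a in A].
pose clK (p : ell2) := forall e : R, 0 < e -> exists2 k, K k & ell2_dot (p - k) (p - k) < e.
pose orthK (p : ell2) := forall k, K k -> ell2_dot p k = 0.
have KD k l : K k -> K l -> K (k + l).
  move=> [a Aa <-] [b Ab <-]; exists (a + b); first exact: AD.
  exact: ell2_ext.
have KZ c k : K k -> K (c *: k).
  move=> [a Aa <-]; exists (c *: a); first exact: AZ.
  exact: ell2_ext.
have K0 : K 0.
  exists (0 *: 1); first exact: AZ.
  by apply: ell2_ext => i /=; rewrite scale0r.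
have orth_cl w p : orthK w -> clK p -> ell2_dot w p = 0.
  move=> wK pK; apply/eqP/negPn/negP => wp0.
  have wp_gt0 : 0 < ell2_dot w p ^+ 2 by rewrite exprn_even_gt0.
  have w1 : 0 < ell2_dot w w + 1 by rewrite ltr_wpDl ?ell2_dot_ge0.
  have [k Kk pk] := pK _ (divr_gt0 wp_gt0 w1).
  have := form_CS ell2_dotC ell2_dotDl ell2_dotZl ell2_dot_ge0 w (p - k).
  have -> : ell2_dot w (p - k) = ell2_dot w p by rewrite !ell2E (wK k) // subr0.
  rewrite leNgt => /negP; apply.
  apply: le_lt_trans (_ : _ <= (ell2_dot w w + 1) * ell2_dot (p - k) (p - k)) _.
    by rewrite ler_wpM2r ?ell2_dot_ge0 // lerDl.
  by rewrite mulrC -ltr_pdivlMr.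
have clD p r : clK p -> clK r -> clK (p + r).
  move=> pK rK d d0; have d4 : 0 < d / 4 by rewrite divr_gt0.
  have [k Kk pk] := pK _ d4; have [l Kl rl] := rK _ d4.
  exists (k + l); first exact: KD.
  have -> : p + r - (k + l) = (p - k) + (r - l) by rewrite opprD addrACA.
  have := ell2_dot_ge0 ((p - k) - (r - l)); move: (p - k) (r - l) pk rl => x y.
  rewrite !ell2E (ell2_dotC y x).
  by move: (ell2_dot x x) (ell2_dot x y) (ell2_dot y y) => a b c; lra.
have clN p : clK p -> clK (- p).
  move=> pK d d0; have [k Kk pk] := pK _ d0; exists (- k).
    by rewrite -scaleN1r; exact: KZ.
  have -> : - p - - k = - (p - k) by rewrite opprB opprK addrC.
  by move: (p - k) pk => x; rewrite !ell2E opprK.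
have clM a p : A a -> clK p -> clK (ell2_map a p).
  move=> Aa pK d d0; have [L L0 aL] := ell2_map_bounded a.
  have [k [b Ab <-] pk] := pK _ (divr_gt0 d0 L0).
  exists (ell2_map (a * b) zeta); first by exists (a * b) => //; exact: AM.
  have -> : ell2_map a p - ell2_map (a * b) zeta = ell2_map a (p - ell2_map b zeta).
    by rewrite ell2_mapB; congr (_ - _); exact: ell2_ext.
  by apply: le_lt_trans (aL _) _; rewrite mulrC -ltr_pdivlMr.
have orthM a w : A a -> orthK w -> orthK (ell2_map a w).
  move=> Aa wK _ [b Ab <-]; rewrite ell2_map_adjoint; apply: wK.
  exists (adjoint a * b); first by apply: AM => //; exact: Aadj.
  exact: ell2_ext.
have /choice[P PP] : forall x, exists p, clK p /\ orthK (x - p).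
  move=> x; have [p [clp orp]] := @orthogonal_projection R ell2 _ ell2_dotC
    ell2_dotDl ell2_dotZl ell2_dot_ge0 (@ell2_complete R H) K x K0 KD (fun t => KZ t%:C).
  by exists p.
have P_uniq x p : clK p -> orthK (x - p) -> P x = p.
  move=> clp orp; have [clP orP] := PP x.
  apply/eqP; rewrite -subr_eq0; apply/eqP/ell2_dot_eq0.
  have cld : clK (P x - p) by apply: (clD _ _ clP); exact: clN.
  have -> : ell2_dot (P x - p) (P x - p) =
      ell2_dot (x - p) (P x - p) - ell2_dot (x - P x) (P x - p).
    have <- := qBl ell2_dotDl ell2_dotZl (x - p) (x - P x) (P x - p).
    by congr ell2_dot; rewrite opprB [RHS]addrC addrA subrK.
  by rewrite (orth_cl _ _ orp cld) (orth_cl _ _ orP cld) subrr.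
have PD x y : P (x + y) = P x + P y.
  have [[clx orx] [cly ory]] := (PP x, PP y); apply: P_uniq; first exact: clD.
  move=> k Kk; have -> : x + y - (P x + P y) = (x - P x) + (y - P y).
    by rewrite opprD addrACA.
  by rewrite ell2_dotDl orx // ory // addr0.
have PM a x : A a -> P (ell2_map a x) = ell2_map a (P x).
  move=> Aa; have [clx orx] := PP x; apply: P_uniq; first exact: clM.
  by rewrite -ell2_mapB; exact: orthM.
have P_le x : ell2_dot (P x) (P x) <= ell2_dot x x.
  have [clx orx] := PP x; have := ell2_dot_ge0 (x - P x).
  have : ell2_dot (x - P x) (P x) = 0 by exact: orth_cl.
  rewrite !ell2E (ell2_dotC (P x) x).
  by move: (ell2_dot x x) (ell2_dot x (P x)) (ell2_dot (P x) (P x)) => a b c; lra.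
pose p_ n m h : H := P (ell2_single m h) n.
have p_A n m a h : A a -> p_ n m (a h) = a (p_ n m h).
  move=> Aa; rewrite /p_; have -> : ell2_single m (a h) = ell2_map a (ell2_single m h).
    by apply: ell2_ext => i /=; rewrite /single; case: ifP => // _; rewrite linear0.
  by rewrite PM.
have p_lin n m : linear (p_ n m).
  move=> c h k; have AcI : A (c *: 1) by exact: AZ.
  have <- : p_ n m (c *: h) = c *: p_ n m h by exact: (p_A n m (c *: 1) h AcI).
  rewrite /p_.
  have -> : ell2_single m (c *: h + k) = ell2_single m (c *: h) + ell2_single m k.
    apply: ell2_ext => i; rewrite ell2_valD /= /single [RHS]/GRing.add /=.
    by case: ifP => // _; rewrite addr0.
  by rewrite PD.
have p_bd n m h : rdot (p_ n m h) (p_ n m h) <= 1 * rdot h h.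
  rewrite mul1r; apply: le_trans (ell2_coord_le _ _) _.
  apply: le_trans (P_le _) _; rewrite ell2_dot_single /= /single eqxx //.
pose p n m : bop H := Bop (@p_lin n m) (bounded_continuous (@p_lin n m) ler01 (@p_bd n m)).
have pA n m : commutant A (p n m).
  by move=> a Aa; apply: bopP => h; exact: p_A.
have TadjA : commutant (commutant A) (adjoint T).
  by apply: commutant_adjoint => //; exact: commutant_adjoint.
pose x := ell2_map T zeta.
have [clx orx] := PP x.
have zetaK : K zeta by exists 1 => //; exact: ell2_ext.
(* The coordinate m of x - P x is its product with a sequence s supported at m;
   T is moved onto s, where its adjoint commutes with P. *)
have xPx : x - P x = 0.
  apply: ell2_ext => m; apply: rdot_eq0.
  set r := x - P x; set h := r m.
  rewrite -(ell2_dot_single r m h); set s := ell2_single m h.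
  have [cls ors] := PP s.
  have -> : ell2_dot r s = ell2_dot x (s - P s).
    transitivity (ell2_dot r (s - P s)).
      by rewrite (qBr ell2_dotC ell2_dotDl ell2_dotZl) (orth_cl r (P s)) // subr0.
    rewrite /r (qBl ell2_dotDl ell2_dotZl) (ell2_dotC (P x)).
    by rewrite (orth_cl _ (P x)) // subr0.
  rewrite /x ell2_map_adjoint.
  have -> : ell2_map (adjoint T) (s - P s) =
      ell2_single m (adjoint T h) - P (ell2_single m (adjoint T h)).
    apply: ell2_ext => n; rewrite /= linearB; congr (_ - _).
      by rewrite /single; case: ifP => // _; rewrite linear0.
    by have /(congr1 (fun S : bop H => S h)) := TadjA _ (pA n m).
  by rewrite ell2_dotC; apply: (PP _).2.
have xK : clK x by have /eqP := xPx; rewrite subr_eq0 => /eqP ->.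
have [_ [a Aa <-] xa] := xK e e0.
exists a => // n; apply: le_lt_trans xa.
exact: (ell2_dot_sqr_cvg (x - ell2_map a zeta)).2 n.
Qed.
End Density.

(** * Normal functionals *)

Section ComplexSeries.
Context {R : realType}.
Local Notation C := (R[i]).

Lemma ge0_RRe (z : C) : 0 <= z -> z = (complex.Re z)%:C.
Proof. by move=> /ger0_Im; case: z => a b /= ->. Qed.

Lemma normc_le_add (z : C) : `|z| <= (`|complex.Re z| + `|complex.Im z|)%:C.
Proof.
rewrite {1}[z]complexE; apply: le_trans (ler_normD _ _) _.
rewrite normrM rmorphD /= lerD //.
  by rewrite normc_def /= expr0n /= addr0 sqrtr_sqr.
rewrite (_ : `|'i%C| = 1 :> C) ?mul1r; last first.
  by rewrite normc_def /= expr0n expr1n add0r sqrtr1.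
by rewrite normc_def /= expr0n /= addr0 sqrtr_sqr.
Qed.

Lemma Re_norm_le (z : C) : `|complex.Re z| <= complex.Re `|z|.
Proof. by rewrite -lecR -ge0_RRe // normc_ge_Re. Qed.

Lemma Im_norm_le (z : C) : `|complex.Im z| <= complex.Re `|z|.
Proof.
have -> : `|complex.Im z| = `|complex.Re (z * 'i%C)| by rewrite ReiNIm normrN.
apply: le_trans (Re_norm_le _) _; rewrite normrM.
rewrite (_ : `|'i%C| = 1 :> C) ?mulr1 //.
by rewrite normc_def /= expr0n expr1n add0r sqrtr1.
Qed.

(** The bound needs the convergence of the series, as the limit of a divergent
    one is an arbitrary default value; the real and imaginary parts converge
    absolutely. *)
Lemma absolutely_summable_lim (z : nat -> C) (K : R) :
  (forall n, \sum_(i < n) complex.Re `|z i| <= K) ->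
  `|limn (series (fun n => z n : C^o))| <= K%:C.
Proof.
move=> zK.
have real_cvg (f : nat -> R) : (forall i, `|f i| <= complex.Re `|z i|) -> cvgn (series f).
  move=> fz; apply: normed_cvg; apply: nondecreasing_is_cvgn.
    by apply/nondecreasing_seqP => n; rewrite /= seriesSr lerDl.
  exists K => _ [n _ <-]; apply: le_trans (zK n).
  by rewrite /= seriesEord; apply: ler_sum => i _.
have /cvg_ex[a za] := real_cvg _ (fun i => Re_norm_le (z i)).
have /cvg_ex[b zb] := real_cvg _ (fun i => Im_norm_le (z i)).
have z_lim : series (fun n => z n : C^o) @ \oo --> (a +i* b : C^o).
  apply/cvgrPdist_lt => eps eps0; have epsE := ge0_RRe (ltW eps0).
  have e0 : 0 < complex.Re eps by rewrite -ltcR -epsE.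
  move: (complex.Re eps) e0 epsE => e e0 -> {eps eps0}.
  have e2 : 0 < e / 2 by rewrite divr_gt0.
  move/cvgrPdist_lt: za => /(_ _ e2) za; move/cvgrPdist_lt: zb => /(_ _ e2) zb.
  near=> n; apply: le_lt_trans (normc_le_add _) _; rewrite ltcR.
  have -> : series (fun n => z n : C^o) n =
      (series (fun i => complex.Re (z i)) n) +i* (series (fun i => complex.Im (z i)) n).
    elim: (n) => [|m IHm]; first by rewrite /series /= !big_geq.
    by rewrite !seriesSr IHm; case: (z m).
  rewrite /= [ltRHS](splitr e); apply: ltrD; near: n; [exact: za|exact: zb].
rewrite (cvg_lim _ z_lim) //.
rewrite [leLHS]ge0_RRe // lecR leNgt; apply/negP => gap.
pose e := complex.Re `|a +i* b| - K.
have e0 : 0 < e%:C :> C by rewrite ltcR subr_gt0.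
move/cvgrPdist_lt: z_lim => /(_ _ e0) [N _ /(_ N (leqnn N))] /=.
rewrite [X in X < _]ge0_RRe // ltcR /e ltrBrDl; apply/negP; rewrite -leNgt.
set s := series _ N.
have sK : complex.Re `|s| <= K.
  apply: le_trans (zK N); rewrite -lecR -ge0_RRe // rmorph_sum /=.
  rewrite /s seriesEord; apply: le_trans (ler_norm_sum _ _ _) _.
  by apply: ler_sum => i _; rewrite -?ge0_RRe.
apply: (@le_trans _ _ (complex.Re `|s| + complex.Re `|(a +i* b) - s|)).
  have := ler_normD s (a +i* b - s); rewrite addrC subrK lecE => /andP[_].
  by case: `|s|; case: `|_ - s|.
by rewrite lerD2r.
Unshelve. all: by end_near. Qed.
End ComplexSeries.

Section Interleave.
Context {R : realType} {H : hilbertType R}.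
Implicit Types (T : bop H) (xi eta zeta : nat -> H).

Definition interleave xi eta : nat -> H := fun m => if odd m then eta m./2 else xi m./2.

Lemma partial_dot_interleave xi eta n :
  partial_dot n.*2 (interleave xi eta) (interleave xi eta) =
  partial_dot n xi xi + partial_dot n eta eta.
Proof.
elim: n => [|n IHn]; first by rewrite /partial_dot !big_ord0 addr0.
rewrite doubleS /partial_dot !big_ord_recr /= -!/(partial_dot _ _ _) IHn.
by rewrite /interleave /= odd_double /= uphalf_double doubleK addrACA -addrA.
Qed.

(** Interleaving turns the finitely many pairs of sequences that define an
    ultraweak neighbourhood into one sequence, to which
    double_commutant_density applies. *)
Lemma common_majorant (s : seq (nat -> H)) :
  (forall xi, xi \in s -> square_sum_bounded xi) ->
  exists2 zeta, square_sum_bounded zeta & forall xi T n, xi \in s -> exists m,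
    partial_dot n (T \o xi) (T \o xi) <= partial_dot m (T \o zeta) (T \o zeta).
Proof.
elim: s => [|xi s IHs] sP.
  by exists 0 => //; exists 0 => n; rewrite /partial_dot big1 // => i _; rewrite /rdot dot0l.
have [|zeta [K zK] zP] := IHs; first by move=> eta es; apply: sP; rewrite inE es orbT.
have [L xL] := sP xi (mem_head _ _).
exists (interleave xi zeta).
  exists (L + K) => n; apply: le_trans (partial_dot_le (n := n.*2) _ _) _.
    by rewrite -addnn leq_addr.
  by rewrite partial_dot_interleave lerD.
have interT T : T \o interleave xi zeta = interleave (T \o xi) (T \o zeta).
  by apply/funext => m; rewrite /interleave /=; case: ifP.
move=> eta T n; rewrite inE => /predU1P[->|/(zP _ T n)[m em]].
  exists n.*2; rewrite interT partial_dot_interleave lerDl; exact: partial_dot_ge0.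
exists m.*2; rewrite interT partial_dot_interleave.
by apply: le_trans em _; rewrite lerDr; exact: partial_dot_ge0.
Qed.
End Interleave.

Section Normality.
Context {R : realType} {H : hilbertType R}.
Local Notation C := (R[i]).
Implicit Types (T : bop H) (xi eta zeta : nat -> H).

Lemma square_summable_bounded xi : square_summable xi -> square_sum_bounded xi.
Proof.
move=> /cvg_seq_bounded /pinfty_ex_gt0 [M M0 xM]; exists (complex.Re M) => n.
have /= := xM n I.
have -> : series (fun n => `|xi n| ^+ 2 : C^o) n = (partial_dot n xi xi)%:C.
  rewrite seriesEord /= /partial_dot rmorph_sum /=; apply: eq_bigr => i _.
  by rewrite normHE dotHH.
rewrite ger0_norm ?ler0c ?partial_dot_ge0 //.
by rewrite {1}(ge0_RRe (ltW M0)) lecR.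
Qed.

(** Termwise |(x, y)| <= |x|^2 / (2 k) + k |y|^2 / 2; the weight k makes the
    resulting bound homogeneous in T. *)
Lemma ultraweak_le xi eta T (k K L d : R) : 0 < k ->
  (forall n, partial_dot n (T \o xi) (T \o xi) <= k ^+ 2 * K) ->
  (forall n, partial_dot n eta eta <= L) -> k * (K + L) / 2 <= d ->
  `|ultraweak_functional xi eta T| <= d%:C.
Proof.
move=> k0 xK eL kd; apply: absolutely_summable_lim => n.
have amgm i : complex.Re `|dotH (T (xi i)) (eta i)| <=
    (2 * k)^-1 * rdot (T (xi i)) (T (xi i)) + k / 2 * rdot (eta i) (eta i).
  set x := T (xi i); set y := eta i.
  have x0 := rdot_ge0 x; have y0 := rdot_ge0 y.
  have r0 : 0 <= (2 * k)^-1 * rdot x x + k / 2 * rdot y y.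
    have k2 : 0 < k / 2 by rewrite divr_gt0.
    have ik : 0 < (2 * k)^-1 by rewrite invr_gt0 mulr_gt0.
    by rewrite addr_ge0 // mulr_ge0 // ltW.
  rewrite -lecR -ge0_RRe //.
  rewrite -(ler_pXn2r (n := 2)) ?nnegrE ?normr_ge0 ?ler0c //.
  apply: le_trans (dot_CS _ _) _; rewrite -rmorphXn /= lecR.
  rewrite -subr_ge0.
  have -> : ((2 * k)^-1 * rdot x x + k / 2 * rdot y y) ^+ 2 - rdot x x * rdot y y =
     ((2 * k)^-1 * rdot x x - k / 2 * rdot y y) ^+ 2.
    by field; lra.
  exact: sqr_ge0.
apply: le_trans (_ : _ <= \sum_(i < n) ((2 * k)^-1 * rdot (T (xi i)) (T (xi i)) +
    k / 2 * rdot (eta i) (eta i))) _.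
  by apply: ler_sum => i _; exact: amgm.
rewrite big_split /= -!mulr_sumr.
apply: le_trans kd.
have -> : k * (K + L) / 2 = (2 * k)^-1 * (k ^+ 2 * K) + k / 2 * L by field; lra.
apply: lerD; rewrite ler_pM2l ?invr_gt0 ?divr_gt0 ?mulr_gt0 //; [exact: xK|exact: eL].
Qed.

Variables (M : set (bop H)) (tau : bop H -> C).
Hypothesis hM : tracial_Wstar_probability_space M tau.

Lemma vn_mem0 : M 0.
Proof.
have [_ <-] := tW_von_neumann hM; move=> s _; by rewrite mul0r mulr0.
Qed.
Lemma vn_memZ c x : M x -> M (c *: x).
Proof.
have [_ ME] := tW_von_neumann hM; rewrite -ME => xM s /xM e.
by rewrite -scalerAl e scalerAr.
Qed.
Lemma vn_tau0 : tau 0 = 0.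
Proof.
have := tW_linear hM 1 vn_mem0 vn_mem0; rewrite scale1r addr0 mul1r => /esym/eqP.
by rewrite -subr_eq0 addrK => /eqP.
Qed.
Lemma vn_tauZ c x : M x -> tau (c *: x) = c * tau x.
Proof. by move=> xM; have := tW_linear hM c xM vn_mem0; rewrite vn_tau0 !addr0. Qed.

(** A small multiple of an operator lies in any given ultraweak neighbourhood
    of 0, at a scale that depends only on the norm of the operator. *)
Lemma tau_norm_bounded : exists2 K : R, 0 < K & forall T (k : R), M T -> 0 < k ->
  (forall u, rdot (T u) (T u) <= k ^+ 2 * rdot u u) -> `|tau T| <= (K * k)%:C.
Proof.
have [d [n [xi [eta [d0 xiS etaS near0]]]]] := tW_normal hM ltr01.
have /choice[K KP] : forall i, exists K : R, forall m, partial_dot m (xi i) (xi i) <= K.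
  by move=> i; exact: square_summable_bounded.
have /choice[L LP] : forall i, exists K : R, forall m, partial_dot m (eta i) (eta i) <= K.
  by move=> i; exact: square_summable_bounded.
pose Q : R := 1 + \sum_i (K i + L i).
have KL i : 0 <= K i + L i.
  have := KP i 0; have := LP i 0; rewrite /partial_dot !big_ord0.
  by move=> ? ?; rewrite addr_ge0.
have Q0 : 0 < Q by rewrite ltr_wpDr // sumr_ge0.
exists (Q / d); first by rewrite divr_gt0.
move=> T k MT k0 Tk; pose s : R := d / (Q * k).
have s0 : 0 < s by rewrite divr_gt0 // mulr_gt0.
have /near0 : M (s%:C *: T) by exact: vn_memZ.
rewrite vn_tauZ // => near_T; have {near_T}h : `|s%:C * tau T| < 1%:C.
  apply: near_T => i; apply: le_lt_trans (_ : _ <= (d / 2)%:C) _; last by rewrite ltcR; lra.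
  apply: (@ultraweak_le _ _ _ (s * k) (K i) (L i)); first exact: mulr_gt0.
  - move=> m; rewrite -/(partial_dot _ _ _) exprMn -mulrA.
    apply: le_trans (_ : _ <= s ^+ 2 * (k ^+ 2 * partial_dot m (xi i) (xi i))) _.
      rewrite /partial_dot !mulr_sumr; apply: ler_sum => j _ /=.
      rewrite rdotZl rdotC rdotZl mulrA -expr2 ler_pM2l ?exprn_gt0 //; exact: Tk.
    by rewrite !ler_pM2l ?exprn_gt0.
  - exact: LP.
  - have -> : s * k * (K i + L i) / 2 = d / 2 * ((K i + L i) / Q) by rewrite /s; field; lra.
    rewrite -[leRHS]mulr1 ler_pM2l ?divr_gt0 // ler_pdivrMr // mul1r /Q.
    by rewrite (bigD1 i) //= addrCA lerDl addr_ge0 // sumr_ge0.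
apply: ltW; move: h; rewrite normrM ger0_norm ?ler0c ?(ltW s0) // => h.
have -> : Q / d * k = s^-1 by rewrite /s; field; lra.
by rewrite fmorphV -div1r ltr_pdivlMr ?ltcR // mulrC.
Qed.

Variable A : set (bop H).
Hypothesis A1 : A 1.
Hypothesis AD : forall a b, A a -> A b -> A (a + b).
Hypothesis AZ : forall (c : R[i]) a, A a -> A (c *: a).
Hypothesis AM : forall a b, A a -> A b -> A (a * b).
Hypothesis Aadj : adjoint_closed A.
Hypothesis MA : forall a T, A a -> M T -> M (adjoint (T - a) * (T - a)).

(** An ultraweak functional of (T - a)^* (T - a) is bounded by the sums of the
    squared norms of the values of T - a along its two sequences. *)
Lemma norm2_density T (e : R) : M T -> commutant (commutant A) T -> 0 < e ->
  exists2 a, A a & `|tau (adjoint (T - a) * (T - a))| < e%:C.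
Proof.
move=> MT TA e0.
have [d [n [xi [eta [d0 xiS etaS near0]]]]] := tW_normal hM e0.
have [|zeta zetaS zetaP] := common_majorant
  (s := [seq xi i | i <- enum 'I_n] ++ [seq eta i | i <- enum 'I_n]).
  move=> ksi; rewrite mem_cat => /orP[] /mapP[i _ ->]; exact: square_summable_bounded.
have zetaE : zeta \in ell2_pred by exact/asboolP.
have d2 : 0 < d / 2 by rewrite divr_gt0.
have [a Aa Ta] := double_commutant_density A1 AD AZ AM Aadj (Ell2 zetaE) TA d2.
exists a => //; apply: near0; first exact: MA.
move=> i; apply: le_lt_trans (_ : _ <= (d / 2)%:C) _; last by rewrite ltcR; lra.
have small ksi : ksi \in [seq xi i | i <- enum 'I_n] ++ [seq eta i | i <- enum 'I_n] ->
    forall m, partial_dot m ((T - a) \o ksi) ((T - a) \o ksi) <= d / 2.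
  move=> ks m; have [m' h] := zetaP _ (T - a) m ks.
  by apply: le_trans h _; apply: ltW; exact: Ta.
have -> : ultraweak_functional (xi i) (eta i) (adjoint (T - a) * (T - a)) =
   ultraweak_functional (xi i) ((T - a) \o eta i) (T - a).
  rewrite /ultraweak_functional; set f := fun m => _; set g := fun m => _.
  suff -> : f = g by [].
  by apply/funext => m; rewrite /f /g /= adjointP adjointK.
apply: (@ultraweak_le _ _ _ 1 (d / 2) (d / 2)) => //.
- move=> m; rewrite expr1n mul1r; apply: small.
  by rewrite mem_cat map_f // mem_enum.
- by move=> m; apply: small; rewrite mem_cat orbC map_f // mem_enum.
- lra.
Qed.

End Normality.

(** * Existence of the free difference quotient *)

Section TensorMaps.
Local Open Scope quotient_scope.
Context {K : fieldType}.

Lemma tens_linearl {U V : lmodType K} c (u u' : U) (v : V) :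
  tens (c *: u + u') v = c *: tens u v + tens u' v.
Proof.
apply: tensor_eqP => W f; rewrite tensor_liftD tensor_liftZ /tens !tensor_liftE !big_seq1 /=.
exact: (linearPl f).
Qed.

Lemma tens_linearr {U V : lmodType K} c (u : U) (v v' : V) :
  tens u (c *: v + v') = c *: tens u v + tens u v'.
Proof.
apply: tensor_eqP => W f; rewrite tensor_liftD tensor_liftZ /tens !tensor_liftE !big_seq1 /=.
exact: (linearPr f).
Qed.

Section Lift.
Context {U V W : lmodType K} (f : U -> V -> W).
Hypothesis fl : forall v, linear (f^~ v).
Hypothesis fr : forall u, linear (f u).

Let bf : {bilinear U -> V -> W} :=
  HB.pack_for {bilinear U -> V -> W} f
    (bilinear_isBilinear.Build K U V W *:%R *:%R f (fl, fr)).

Lemma tensor_lift_linear : linear (tensor_lift f).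
Proof.
move=> c s t; rewrite [LHS](tensor_liftD bf); congr (_ + _).
exact: (tensor_liftZ bf).
Qed.

Lemma tensor_lift_tens u v : tensor_lift f (tens u v) = f u v.
Proof. by rewrite [LHS](tensor_liftE _ bf) big_seq1. Qed.

End Lift.

(** Elementary tensors span. *)
Lemma tensor_eq_linear {U V W : lmodType K} (f g : tensor U V -> W) :
  linear f -> linear g -> (forall u v, f (tens u v) = g (tens u v)) -> f =1 g.
Proof.
move=> lf lg fg t.
have morph (h : tensor U V -> W) : linear h -> (forall s t, h (s + t) = h s + h t) * (h 0 = 0).
  move=> lh; have hD s r : h (s + r) = h s + h r by rewrite -[s]scale1r lh !scale1r.
  by split=> //; apply: (addrI (h 0)); rewrite -hD !addr0.
rewrite -[t]reprK; elim: (repr t) => [|p s IHs].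
  by have -> : \pi_(tensor U V) [::] = 0 by []; rewrite (morph f) // (morph g).
have -> : \pi_(tensor U V) (p :: s) = tens p.1 p.2 + \pi_(tensor U V) s.
  apply: tensor_eqP => W' h.
  by rewrite tensor_liftD /tens !tensor_liftE big_cons big_seq1.
by rewrite !(morph f) // !(morph g) // fg IHs.
Qed.

Context {A : algType K}.
Implicit Types (a b c d : A) (s t : tensor A A).

Lemma lact_fl a (v : A) : linear (fun u : A => tens (a * u) v).
Proof. by move=> c x y; rewrite mulrDr -scalerAr tens_linearl. Qed.
Lemma ract_fr d (u : A) : linear (fun v : A => tens u (v * d)).
Proof. by move=> c x y; rewrite mulrDl -scalerAl tens_linearr. Qed.

Lemma lact_linear a : linear (tensor_lact a).
Proof. apply: tensor_lift_linear => [v|u c x y]; [exact: lact_fl|exact: tens_linearr]. Qed.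
Lemma ract_linear d : linear ((@tensor_ract _ A)^~ d).
Proof. apply: tensor_lift_linear => [v c x y|u]; [exact: tens_linearl|exact: ract_fr]. Qed.
Lemma lact_tens a b c : tensor_lact a (tens b c) = tens (a * b) c.
Proof. apply: tensor_lift_tens => [v|u k x y]; [exact: lact_fl|exact: tens_linearr]. Qed.
Lemma ract_tens b c d : tensor_ract (tens b c) d = tens b (c * d).
Proof. apply: tensor_lift_tens => [v k x y|u]; [exact: tens_linearl|exact: ract_fr]. Qed.

Lemma linear_compose {U V W : lmodType K} (f : V -> W) (g : U -> V) :
  linear f -> linear g -> linear (fun x => f (g x)).
Proof. by move=> lf lg c x y; rewrite lg lf. Qed.
Lemma linear_idfun {U : lmodType K} : linear (fun x : U => x). Proof. by []. Qed.
Lemma linear_combine {U V : lmodType K} k (f g : U -> V) :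
  linear f -> linear g -> linear (fun x => k *: f x + g x).
Proof.
by move=> lf lg c x y; rewrite lf lg !scalerDr !scalerA mulrC addrACA.
Qed.

Lemma lact1 t : tensor_lact 1 t = t.
Proof.
move: t; apply: tensor_eq_linear; [exact: lact_linear|exact: linear_idfun|].
by move=> b c; rewrite lact_tens mul1r.
Qed.
Lemma ract1 t : tensor_ract t 1 = t.
Proof.
move: t; apply: tensor_eq_linear; [exact: ract_linear|exact: linear_idfun|].
by move=> b c; rewrite ract_tens mulr1.
Qed.
Lemma lactM a b t : tensor_lact (a * b) t = tensor_lact a (tensor_lact b t).
Proof.
move: t; apply: tensor_eq_linear; first exact: lact_linear.
  by apply: linear_compose; exact: lact_linear.
by move=> c d; rewrite !lact_tens mulrA.
Qed.
Lemma ractM t c d : tensor_ract t (c * d) = tensor_ract (tensor_ract t c) d.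
Proof.
move: t; apply: tensor_eq_linear; first exact: ract_linear.
  by apply: (@linear_compose _ _ _ ((@tensor_ract _ A)^~ d)); exact: ract_linear.
by move=> a b; rewrite !ract_tens mulrA.
Qed.
Lemma lactP k a b t :
  tensor_lact (k *: a + b) t = k *: tensor_lact a t + tensor_lact b t.
Proof.
move: t; apply: tensor_eq_linear; first exact: lact_linear.
  by apply: linear_combine; exact: lact_linear.
by move=> c d; rewrite !lact_tens mulrDl -scalerAl tens_linearl.
Qed.
Lemma ractP k t c d :
  tensor_ract t (k *: c + d) = k *: tensor_ract t c + tensor_ract t d.
Proof.
move: t; apply: tensor_eq_linear; first exact: ract_linear.
  by apply: (@linear_combine _ _ _ ((@tensor_ract _ A)^~ c)); exact: ract_linear.
by move=> a b; rewrite !ract_tens mulrDr -scalerAr tens_linearr.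
Qed.
Lemma lact_ract a t d : tensor_lact a (tensor_ract t d) = tensor_ract (tensor_lact a t) d.
Proof.
move: t; apply: tensor_eq_linear.
- by apply: linear_compose; [exact: lact_linear|exact: ract_linear].
- by apply: (@linear_compose _ _ _ ((@tensor_ract _ A)^~ d)); [exact: ract_linear|exact: lact_linear].
- by move=> b c; rewrite !(lact_tens, ract_tens).
Qed.

Lemma linear_additive {U V : lmodType K} (f : U -> V) x y : linear f -> f (x + y) = f x + f y.
Proof. by move=> lf; rewrite -[x in LHS]scale1r lf scale1r. Qed.
Lemma linear_zero {U V : lmodType K} (f : U -> V) : linear f -> f 0 = 0.
Proof. by move=> lf; apply: (addrI (f 0)); rewrite -linear_additive // !addr0. Qed.
Lemma linear_scale {U V : lmodType K} (f : U -> V) k x : linear f -> f (k *: x) = k *: f x.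
Proof. by move=> lf; rewrite -[_ *: _]addr0 lf linear_zero // addr0. Qed.
Lemma lactDl a b t : tensor_lact (a + b) t = tensor_lact a t + tensor_lact b t.
Proof. by have := lactP 1 a b t; rewrite !scale1r. Qed.
Lemma ractDr t a b : tensor_ract t (a + b) = tensor_ract t a + tensor_ract t b.
Proof. by have := ractP 1 t a b; rewrite !scale1r. Qed.
Lemma lactZl k a t : tensor_lact (k *: a) t = k *: tensor_lact a t.
Proof. by apply: (@linear_scale _ _ ((@tensor_lact _ A)^~ t)) => c x y; exact: lactP. Qed.
Lemma ractZr k t a : tensor_ract t (k *: a) = k *: tensor_ract t a.
Proof. by apply: (@linear_scale _ _ (@tensor_ract _ A t)) => c x y; exact: ractP. Qed.
End TensorMaps.

Section SquareZeroExtension.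
Context {K : fieldType} (A : algType K).

(** The square-zero extension: a derivation from A to its tensor square is the
    second component of a homomorphism into it. *)
Definition extension := (A * tensor A A)%type.
HB.instance Definition _ := GRing.Lmodule.on extension.
Implicit Types x y z : extension.

Definition ext_one : extension := (1, 0).
Definition ext_mul x y : extension :=
  (x.1 * y.1, tensor_lact x.1 y.2 + tensor_ract x.2 y.1).

Lemma ext_eq x y : x.1 = y.1 -> x.2 = y.2 -> x = y.
Proof. by case: x => a s; case: y => b t /= -> ->. Qed.

Fact ext_mulA : associative ext_mul.
Proof.
move=> x y z; apply: ext_eq => /=; first exact: mulrA.
rewrite (linear_additive _ _ (lact_linear _)) (linear_additive _ _ (ract_linear _)).
by rewrite lactM ractM lact_ract addrA.
Qed.
Fact ext_mul1 : left_id ext_one ext_mul.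
Proof.
move=> x; apply: ext_eq => /=; first exact: mul1r.
by rewrite lact1 (linear_zero (ract_linear _)) addr0.
Qed.
Fact ext_1mul : right_id ext_one ext_mul.
Proof.
move=> x; apply: ext_eq => /=; first exact: mulr1.
by rewrite ract1 (linear_zero (lact_linear _)) add0r.
Qed.
Fact ext_mulDl : left_distributive ext_mul +%R.
Proof.
move=> x y z; apply: ext_eq => /=; first exact: mulrDl.
by rewrite lactDl (linear_additive _ _ (ract_linear _)) addrACA.
Qed.
Fact ext_mulDr : right_distributive ext_mul +%R.
Proof.
move=> x y z; apply: ext_eq => /=; first exact: mulrDr.
by rewrite ractDr (linear_additive _ _ (lact_linear _)) addrACA.
Qed.
Fact ext_one_neq0 : ext_one != 0 :> extension.
Proof. by apply/eqP => /(congr1 fst) /eqP; rewrite oner_eq0. Qed.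
HB.instance Definition _ := GRing.Zmodule_isNzRing.Build extension
  ext_mulA ext_mul1 ext_1mul ext_mulDl ext_mulDr ext_one_neq0.

Fact ext_scaleAl (c : K) x y : c *: (x * y) = c *: x * y.
Proof.
apply: ext_eq => /=; first exact: scalerAl.
by rewrite lactZl (linear_scale _ _ (ract_linear _)) scalerDr.
Qed.
HB.instance Definition _ := GRing.Lmodule_isLalgebra.Build K extension ext_scaleAl.
Fact ext_scaleAr (c : K) x y : c *: (x * y) = x * (c *: y).
Proof.
apply: ext_eq => /=; first exact: scalerAr.
by rewrite ractZr (linear_scale _ _ (lact_linear _)) scalerDr.
Qed.
HB.instance Definition _ := GRing.Lalgebra_isAlgebra.Build K extension ext_scaleAr.

End SquareZeroExtension.

Section FreeDifferenceQuotientExists.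
Context {K : fieldType}.

Definition ext_fst (A : algType K) (x : extension A) : A := x.1.
Fact ext_fst_linear (A : algType K) : linear (@ext_fst A). Proof. by []. Qed.
HB.instance Definition _ (A : algType K) :=
  GRing.isLinear.Build K (extension A) A *:%R (@ext_fst A) (@ext_fst_linear A).
Fact ext_fst_monoid (A : algType K) : monoid_morphism (@ext_fst A). Proof. by []. Qed.
HB.instance Definition _ (A : algType K) :=
  GRing.isMonoidMorphism.Build (extension A) A (@ext_fst A) (@ext_fst_monoid A).

Definition ext_inl (A : algType K) (a : A) : extension A := (a, 0).
Fact ext_inl_linear (A : algType K) : linear (@ext_inl A).
Proof. by move=> c x y; apply: ext_eq => //=; rewrite scaler0 addr0. Qed.
HB.instance Definition _ (A : algType K) :=
  GRing.isLinear.Build K A (extension A) *:%R (@ext_inl A) (@ext_inl_linear A).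
Fact ext_inl_monoid (A : algType K) : monoid_morphism (@ext_inl A).
Proof.
split=> // x y; apply: ext_eq => //=.
by rewrite (linear_zero (lact_linear _)) (linear_zero (ract_linear _)) addr0.
Qed.
HB.instance Definition _ (A : algType K) :=
  GRing.isMonoidMorphism.Build A (extension A) (@ext_inl A) (@ext_inl_monoid A).

(** horner_alg, made linear for the scaling of E so that it is a homomorphism
    of algebras. *)
Definition alg_eval (E : algType K) (x : E) (p : {poly K}) : E := horner_alg x p.
Fact alg_eval_linear (E : algType K) (x : E) : linear (alg_eval x).
Proof.
move=> c p q; rewrite /alg_eval rmorphD /= -mul_polyC rmorphM /= horner_algC.
by rewrite mulr_algl.
Qed.
HB.instance Definition _ (E : algType K) (x : E) :=
  GRing.isLinear.Build K {poly K} E *:%R (alg_eval x) (alg_eval_linear x).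
Fact alg_eval_monoid (E : algType K) (x : E) : monoid_morphism (alg_eval x).
Proof. by split=> [|p q]; rewrite /alg_eval ?rmorph1 ?rmorphM. Qed.
HB.instance Definition _ (E : algType K) (x : E) :=
  GRing.isMonoidMorphism.Build {poly K} E (alg_eval x) (alg_eval_monoid x).

Context {A : algType K}.

(** By the universal property, b -> (b, 0) and X -> (X, 1 (x) 1) extend to a
    homomorphism g into the square-zero extension.  By uniqueness its first
    component is the identity; the second component is then a derivation. *)
Lemma free_difference_quotient_exists (B : subalgClosed A) (X : A) :
  algebraically_free B X ->
  exists d, is_free_difference_quotient (B := B) (X := X) d.
Proof.
move=> [P [i [j [univ [phi [phi_i phi_j [psi psiK phiK]]]]]]].
pose x : subalg (adjoin B X) := phi (j 'X).
pose E : algType K := extension (subalg (adjoin B X)).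
pose xt : E := (x, tens 1 1).
pose f2 : {lrmorphism {poly K} -> E} := alg_eval xt.
have [[g [gi gj]] _] := univ _ (@ext_inl _ \o phi \o i : {lrmorphism _ -> _}) f2.
have [_ uniq] := univ _ (phi \o i : {lrmorphism _ -> _}) (phi \o j : {lrmorphism _ -> _}).
have gphi : @ext_fst _ \o g =1 phi.
  apply: uniq => [b|p] /=; first by have /= -> := gi b.
  rewrite [LHS](poly_alg_initial (@ext_fst _ \o g \o j : {lrmorphism _ -> _})).
  rewrite [RHS](poly_alg_initial (phi \o j : {lrmorphism _ -> _})) /=.
  by have /= -> := gj 'X; rewrite /f2 /= /alg_eval horner_algX.
exists (fun m => (g (psi m)).2); split.
- move=> c m1 m2; rewrite -{1}[m1]phiK -{1}[m2]phiK -linearP psiK.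
  by rewrite linearP.
- move=> m1 m2; rewrite -{1}[m1]phiK -{1}[m2]phiK -rmorphM psiK rmorphM /=.
  by rewrite -![(g _).1]/(ext_fst _) -![ext_fst _]/((@ext_fst _ \o g) _) !gphi !phiK.
- move=> m mX; have -> : m = phi (j 'X) by apply: val_inj; rewrite phi_j.
  by rewrite psiK; have /= -> := gj 'X; rewrite /f2 /= /alg_eval horner_algX.
- move=> b bB; have -> : b = phi (i (Sub (val b) bB)).
    by apply: val_inj; rewrite phi_i SubK.
  by rewrite psiK; have /= -> := gi (Sub (val b) bB).
Qed.

Lemma free_difference_quotientP (B : subalgClosed A) (X : A) :
  algebraically_free B X ->
  is_free_difference_quotient (@free_difference_quotient K A B X).
Proof.
move=> /free_difference_quotient_exists[d dP].
by rewrite /free_difference_quotient; case: xgetP => // /(_ d).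
Qed.

End FreeDifferenceQuotientExists.

(** * Integrals of polynomials *)

Section PolynomialIntegrals.
Context {R : realType} (mu : probability (measurableTypeR R) R) (r : R).
Hypothesis mu_r : mu [set x : R | - r <= x <= r] = 1%E.
Implicit Types (p q : {poly R}).

Let D : set R := [set x : R | - r <= x <= r].

Let D_itv : D = `[- r, r]%classic.
Proof. by apply/seteqP; split=> x; rewrite /D /= in_itv. Qed.
Let mD : measurable (D : set (measurableTypeR R)).
Proof. by rewrite D_itv; exact: measurable_itv. Qed.
Let muDc : mu (~` D) = 0%E.
Proof. by rewrite probability_setC // mu_r subee. Qed.

Let mpoly p (A : set R) : measurable_fun (A : set (measurableTypeR R)) (horner p) :=
  measurable_poly p (A := A).

Let integrable_support p : mu.-integrable D (EFin \o horner p).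
Proof.
apply: measurable_bounded_integrable => //.
  by rewrite [ltLHS]mu_r ltry.
have : bounded_set (horner p @` D).
  apply: compact_bounded; apply: continuous_compact.
    by apply: continuous_subspaceT; exact: continuous_horner.
  by rewrite D_itv; exact: segment_compact.
move=> [M [Mr MP]]; exists M; split=> // y My x Dx.
by apply: MP => //; exists x.
Qed.

Let integrable_poly p : mu.-integrable setT (EFin \o horner p).
Proof.
apply/(@negligible_integrable _ _ _ mu setT (~` D)) => //.
- exact: measurableC.
- by apply/measurable_EFinP; exact: mpoly.
- by rewrite setTD setCK.
Qed.

Definition moment p : R := \int[mu]_x p.[x].

Let moment_support p : moment p = \int[mu]_(x in D) p.[x].
Proof.
rewrite /moment /Rintegral (@negligible_integral _ _ _ mu setT (~` D)) //.
- by rewrite setTD setCK.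
- exact: measurableC.
- exact: integrable_poly.
Qed.

Lemma moment_linear (c : R) p q : moment (c *: p + q) = c * moment p + moment q.
Proof.
transitivity (\int[mu]_x ((c *: p).[x] + q.[x])).
  by apply: eq_Rintegral => x _; rewrite hornerD.
rewrite (RintegralD measurableT (integrable_poly (c *: p)) (integrable_poly q)); congr (_ + _).
rewrite /moment -(RintegralZl c measurableT (integrable_poly p)).
by apply: eq_Rintegral => x _; rewrite hornerZ.
Qed.

Lemma moment_le p q : (forall x, - r <= x <= r -> p.[x] <= q.[x]) -> moment p <= moment q.
Proof. by move=> pq; rewrite !moment_support; apply: le_Rintegral. Qed.

(** Dominated convergence; s is a null point at which p_ need not tend to 0,
    the point of the diagonal in the application. *)
Lemma moment_cvg0 (p_ : nat -> {poly R}) (K s : R) : mu [set s] = 0%E ->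
  (forall n x, - r <= x <= r -> 0 <= (p_ n).[x] <= K) ->
  (forall x, - r <= x <= r -> x != s -> (fun n => (p_ n).[x]) @ \oo --> (0 : R)) ->
  (fun n => moment (p_ n)) @ \oo --> (0 : R).
Proof.
move=> mus pK p0.
have [] := @dominated_convergence _ _ _ mu D mD (fun n => EFin \o horner (p_ n))
   (cst 0%E) (cst K%:E).
- by move=> n; apply/measurable_EFinP; exact: mpoly.
- exact: measurable_cst.
- exists [set s]; split=> //.
  move=> x /= xP; apply/eqP/negPn/negP => xs; apply: xP => Dx.
  by apply: cvg_EFin; [exact: nearW|exact: p0].
- exact: finite_measure_integrable_cst.
- apply: aeW => x n Dx /=; rewrite lee_fin ger0_norm; by have /andP[] := pK n x Dx.
move=> _ _; rewrite integral_cst // mul0e => lim0.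
have -> : (fun n => moment (p_ n)) = (fun n => fine (\int[mu]_(x in D) (EFin \o horner (p_ n)) x)%E).
  by apply/funext => n; rewrite moment_support.
exact: (fine_cvg lim0).
Qed.
End PolynomialIntegrals.

(** * Tracial star-algebras *)

Section NormSquare.
Context {R : realType}.
Local Notation C := (R[i]).
Implicit Types z w : C.

(** The squared modulus as an element of R rather than of R[i], so that real
    linear arithmetic applies to it. *)
Definition normsq z : R := complex.Re z ^+ 2 + complex.Im z ^+ 2.

Lemma normsqE z : `|z| ^+ 2 = (normsq z)%:C.
Proof. by rewrite add_Re2_Im2. Qed.
Lemma normsq_ge0 z : 0 <= normsq z.
Proof. by rewrite addr_ge0 ?sqr_ge0. Qed.
Lemma normsqM z w : normsq (z * w) = normsq z * normsq w.
Proof. by case: z => a b; case: w => c d; rewrite /normsq /=; ring. Qed.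
Lemma normsqD z w : normsq (z + w) <= 2 * normsq z + 2 * normsq w.
Proof.
case: z => a b; case: w => c d; rewrite /normsq /=.
by have := sqr_ge0 (a - c); have := sqr_ge0 (b - d); lra.
Qed.
Lemma normsqN z : normsq (- z) = normsq z.
Proof. by case: z => a b; rewrite /normsq /= !sqrrN. Qed.
Lemma normsq_eq0 z : normsq z = 0 -> z = 0.
Proof.
move=> z0; apply/eqP; rewrite -normr_eq0 -sqrf_eq0 normsqE z0; exact: eqxx.
Qed.
Lemma normsq_small z : (forall e : R, 0 < e -> normsq z <= e) -> z = 0.
Proof.
move=> ze; apply: normsq_eq0; apply/eqP; rewrite eq_le normsq_ge0 andbT.
by apply/ler_addgt0Pl => e e0; rewrite addr0; exact: ze.
Qed.
End NormSquare.

(** The trace and the involution of a von Neumann algebra, without its topology.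
    The field tau_growth is what is kept of the continuity of the trace for the
    operator norm, in the form that nsq_mull uses. *)
Record tracial_star_algebra (R : realType) (M : algType R[i]) (star : M -> M)
    (tau : M -> R[i]) : Prop := {
  starD : forall x y, star (x + y) = star x + star y;
  starZ : forall c x, star (c *: x) = c^*%C *: star x;
  starM : forall x y, star (x * y) = star y * star x;
  starK : involutive star;
  tauP : forall c x y, tau (c *: x + y) = c * tau x + tau y;
  tau_ge0 : forall x, 0 <= tau (star x * x);
  tau_faithful : forall x, tau (star x * x) = 0 -> x = 0;
  tauC : forall x y, tau (x * y) = tau (y * x);
  tau1 : tau 1 = 1;
  tau_growth : forall b, exists2 k : R, 0 < k & forall x, exists K : R, forall n,
    complex.Re (tau (star x * (star b * b) ^+ n * x)) <= K * k ^+ n }.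

Lemma bernoulli (R : realFieldType) (x : R) n : 0 <= x -> 1 + n%:R * x <= (1 + x) ^+ n.
Proof.
move=> x0; elim: n => [|n IHn]; first by rewrite mul0r addr0.
rewrite exprS mulrDl mul1r -natr1 mulrDl mul1r addrA; apply: lerD => //.
rewrite -[leLHS]mulr1 ler_wpM2l //; apply: le_trans IHn.
by rewrite lerDl mulr_ge0.
Qed.

(** A sequence that squares at each step cannot start above k N without
    outgrowing every multiple of k ^ (2 ^ n). *)
Lemma squaring_growth (R : archiRealFieldType) (a : nat -> R) (N K k : R) : 0 <= N -> 0 < k ->
  (forall n, a n ^+ 2 <= N * a n.+1) -> (forall n, a n <= K * k ^+ (2 ^ n)) -> a 0 <= k * N.
Proof.
move=> N_ge0 k_gt0 aN aK; rewrite leNgt; apply/negP => a0.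
have a0_gt0 : 0 < a 0 by apply: le_lt_trans a0; rewrite mulr_ge0 // ltW.
have N_gt0 : 0 < N.
  rewrite lt_def N_ge0 andbT; apply/eqP => N0.
  have := aN 0; rewrite N0 mul0r leNgt => /negP; apply.
  by rewrite exprn_gt0.
pose c : R := a 0 / (k * N).
have kN : 0 < k * N by rewrite mulr_gt0.
have c_gt1 : 1 < c by rewrite ltr_pdivlMr // mul1r.
have c_gt0 : 0 < c by exact: lt_trans c_gt1.
have grow n : N * (k * c) ^+ (2 ^ n) <= a n.
  elim: n => [|n IHn].
    rewrite expn0 expr1.
    have -> : N * (k * c) = c * (k * N) by ring.
    by rewrite /c divfK // gt_eqF.
  rewrite -(ler_pM2l N_gt0); apply: le_trans (aN n).
  apply: le_trans (_ : _ <= (N * (k * c) ^+ (2 ^ n)) ^+ 2) _.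
    rewrite expnSr exprM; move: (_ ^+ (2 ^ n)) => E.
    by have -> : N * (N * E ^+ 2) = (N * E) ^+ 2 by ring.
  have E_ge0 : 0 <= N * (k * c) ^+ (2 ^ n) by rewrite mulr_ge0 // exprn_ge0 // mulr_ge0 ?(ltW k_gt0) ?(ltW c_gt0).
  by rewrite ler_pXn2r // nnegrE //; exact: le_trans IHn.
have cK n : N * c ^+ (2 ^ n) <= K.
  have := le_trans (grow n) (aK n); rewrite exprMn mulrCA mulrC.
  by rewrite ler_pM2r ?exprn_gt0.
pose n := (Num.trunc (`|K| / (N * (c - 1)))).+1.
have Nc : 0 < N * (c - 1) by rewrite mulr_gt0 // subr_gt0.
have : `|K| / (N * (c - 1)) < n%:R by exact: truncnS_gt.
rewrite ltr_pdivrMr // ltNge => /negP; apply.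
apply: le_trans (ler_norm K); apply: le_trans (cK n).
rewrite mulrCA ler_pM2l //.
have : 1 + (2 ^ n)%:R * (c - 1) <= c ^+ (2 ^ n).
  have := @bernoulli _ (c - 1) (2 ^ n); rewrite [1 + (c - 1)]addrC subrK; apply.
  by rewrite subr_ge0 ltW.
apply: le_trans; apply: le_trans (_ : _ <= (2 ^ n)%:R * (c - 1)) _; last by rewrite lerDr.
apply: ler_wpM2r; first by rewrite subr_ge0 ltW.
by rewrite ler_nat ltnW // ltn_expl.
Qed.

Section TracialStarAlgebra.
Context {R : realType} {M : algType R[i]} {star : M -> M} {tau : M -> R[i]}.
Hypothesis hT : tracial_star_algebra star tau.
Local Notation C := (R[i]).
Implicit Types x y z : M.

Lemma traceD x y : tau (x + y) = tau x + tau y.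
Proof. by have := tauP hT 1 x y; rewrite scale1r mul1r. Qed.
Lemma trace0 : tau 0 = 0.
Proof. by apply: (addrI (tau 0)); rewrite -traceD !addr0. Qed.
Lemma traceZ c x : tau (c *: x) = c * tau x.
Proof. by have := tauP hT c x 0; rewrite trace0 !addr0. Qed.
Lemma traceN x : tau (- x) = - tau x.
Proof. by rewrite -scaleN1r traceZ mulN1r. Qed.
Lemma traceB x y : tau (x - y) = tau x - tau y.
Proof. by rewrite traceD traceN. Qed.
Lemma trace_sum (I : Type) (s : seq I) (f : I -> M) :
  tau (\sum_(i <- s) f i) = \sum_(i <- s) tau (f i).
Proof. exact: (big_morph tau traceD trace0). Qed.

Lemma star1 : star 1 = 1.
Proof. by have := starM hT (star 1) 1; rewrite mulr1 (starK hT) mulr1. Qed.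
Lemma star0 : star 0 = 0.
Proof. by have := starZ hT 0 0; rewrite !scale0r conjc0 scale0r. Qed.
Lemma starN x : star (- x) = - star x.
Proof. by rewrite -(scaleN1r x) (starZ hT) rmorphN1 scaleN1r. Qed.
Lemma starB x y : star (x - y) = star x - star y.
Proof. by rewrite (starD hT) starN. Qed.

Definition tau_ip x y : C := tau (star y * x).
Definition tau_rip x y : R := complex.Re (tau_ip x y).
Definition tau_nsq x : R := tau_rip x x.

Lemma ipDl x y z : tau_ip (x + y) z = tau_ip x z + tau_ip y z.
Proof. by rewrite /tau_ip mulrDr traceD. Qed.
Lemma ipZl c x y : tau_ip (c *: x) y = c * tau_ip x y.
Proof. by rewrite /tau_ip -scalerAr traceZ. Qed.
Lemma ipDr x y z : tau_ip z (x + y) = tau_ip z x + tau_ip z y.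
Proof. by rewrite /tau_ip (starD hT) mulrDl traceD. Qed.
Lemma ipZr c x y : tau_ip x (c *: y) = c^*%C * tau_ip x y.
Proof. by rewrite /tau_ip (starZ hT) -scalerAl traceZ. Qed.
Lemma ip_ge0 x : 0 <= tau_ip x x. Proof. exact: (tau_ge0 hT). Qed.

(** Polarization: the form is real at x + y and at x + i y. *)
Lemma ipC x y : tau_ip y x = (tau_ip x y)^*%C.
Proof.
have := ip_ge0 (x + 'i%C *: y); have := ip_ge0 (x + y); have := ip_ge0 x; have := ip_ge0 y.
rewrite !(ipDl, ipDr, ipZl, ipZr).
case: (tau_ip x x) => a a'; case: (tau_ip y y) => b b'.
case: (tau_ip x y) => c c'; case: (tau_ip y x) => d d'.
rewrite !lecE /= => /andP[/eqP b0 _] /andP[/eqP a0 _] /andP[/eqP h1 _] /andP[/eqP h2 _].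
by apply/eqP; rewrite eq_complex /=; apply/andP; split; apply/eqP; lra.
Qed.

Lemma ripC x y : tau_rip x y = tau_rip y x.
Proof. by rewrite /tau_rip ipC; case: (tau_ip y x). Qed.
Lemma ripDl x y z : tau_rip (x + y) z = tau_rip x z + tau_rip y z.
Proof. by rewrite /tau_rip ipDl; case: (tau_ip x z); case: (tau_ip y z). Qed.
Lemma ripZl (t : R) x y : tau_rip (t%:C *: x) y = t * tau_rip x y.
Proof. by rewrite /tau_rip ipZl; case: (tau_ip x y) => a b /=; rewrite mul0r subr0. Qed.
Lemma nsq_ge0 x : 0 <= tau_nsq x.
Proof. by rewrite -ler0c /tau_nsq /tau_rip -ge0_RRe ip_ge0. Qed.
Lemma ipE x : tau_ip x x = (tau_nsq x)%:C.
Proof. by rewrite /tau_nsq /tau_rip -ge0_RRe // ip_ge0. Qed.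
Lemma nsq_eq0 x : tau_nsq x = 0 -> x = 0.
Proof. by move=> x0; apply: (tau_faithful hT); rewrite -/(tau_ip x x) ipE x0. Qed.
Definition ripE := qE ripC ripDl ripZl.

Lemma nsqD x y : tau_nsq (x + y) <= 2 * tau_nsq x + 2 * tau_nsq y.
Proof.
have := nsq_ge0 (x - y); rewrite /tau_nsq !ripE (ripC y x).
by move: (tau_rip x x) (tau_rip x y) (tau_rip y y) => a b c; lra.
Qed.
Lemma nsqN x : tau_nsq (- x) = tau_nsq x.
Proof. by rewrite /tau_nsq !ripE opprK. Qed.
Lemma nsq_star x : tau_nsq (star x) = tau_nsq x.
Proof. by rewrite /tau_nsq /tau_rip /tau_ip (starK hT) (tauC hT). Qed.

Lemma ip_CS x y : normsq (tau_ip x y) <= tau_nsq x * tau_nsq y.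
Proof.
rewrite -lecR -normsqE rmorphM /= -!ipE; apply: hermitian_CS.
- exact: ipC.
- exact: ipDl.
- exact: ipZl.
- exact: ip_ge0.
Qed.
Lemma trace_CS x y : normsq (tau (x * y)) <= tau_nsq x * tau_nsq y.
Proof. by have := ip_CS y (star x); rewrite /tau_ip (starK hT) nsq_star mulrC. Qed.

(** With h = b* b, the numbers tau (x* h^(2^n) x) square at each step by the
    Cauchy-Schwarz inequality, and grow geometrically in 2^n; this bounds the
    first of them. *)
Lemma nsq_mull b : exists2 K : R, 0 < K & forall x, tau_nsq (b * x) <= K * tau_nsq x.
Proof.
have [k k_gt0 growth] := tau_growth hT b; exists k => // x.
have [K xK] := growth x.
pose h := star b * b.
have h_sa n : star (h ^+ n) = h ^+ n.
  elim: n => [|n IHn]; first by rewrite expr0 star1.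
  by rewrite exprS (starM hT) IHn /h (starM hT) (starK hT) -/h -exprSr exprS.
pose a n := complex.Re (tau (star x * h ^+ (2 ^ n) * x)).
have -> : tau_nsq (b * x) = a 0.
  by rewrite /tau_nsq /tau_rip /tau_ip /a expn0 expr1 (starM hT) /h !mulrA.
apply: (squaring_growth (K := K) (nsq_ge0 x) k_gt0) => n; last exact: xK.
have -> : a n.+1 = tau_nsq (h ^+ (2 ^ n) * x).
  by rewrite /a /tau_nsq /tau_rip /tau_ip (starM hT) h_sa expnS mul2n -addnn exprD !mulrA.
apply: le_trans (_ : _ <= normsq (tau_ip (h ^+ (2 ^ n) * x) x)) _.
  by rewrite /a /tau_ip mulrA /normsq lerDl sqr_ge0.
by rewrite mulrC; exact: ip_CS.
Qed.
Lemma nsq_mulr b : exists2 K : R, 0 < K & forall x, tau_nsq (x * b) <= K * tau_nsq x.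
Proof.
have [K K0 bK] := nsq_mull (star b); exists K => // x.
by rewrite -nsq_star (starM hT) -(nsq_star x).
Qed.

End TracialStarAlgebra.

(** * Averaging over a diffuse element *)

Section PolynomialCalculus.
Context {R : realType} {M : algType R[i]} {star : M -> M} {tau : M -> R[i]}.
Hypothesis hT : tracial_star_algebra star tau.
Local Notation C := (R[i]).
Local Notation nsq := (@tau_nsq R M star tau).
Local Notation rip := (@tau_rip R M star tau).
Implicit Types (x y z : M) (p q t : {poly R}).
Variable b : M.

Definition ev p : M := horner_alg b (map_poly (real_complex R) p).

Lemma evD p q : ev (p + q) = ev p + ev q.
Proof. by rewrite /ev !rmorphD. Qed.
Lemma evM p q : ev (p * q) = ev p * ev q.
Proof. by rewrite /ev !rmorphM. Qed.
Lemma ev1 : ev 1 = 1.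
Proof. by rewrite /ev !rmorph1. Qed.
Lemma ev0 : ev 0 = 0.
Proof. by rewrite /ev !rmorph0. Qed.
Lemma evX : ev 'X = b.
Proof. by rewrite /ev map_polyX horner_algX. Qed.
Lemma evC (c : R) : ev c%:P = c%:C%:A.
Proof. by rewrite /ev map_polyC horner_algC. Qed.
Lemma evZ (c : R) p : ev (c *: p) = c%:C *: ev p.
Proof. by rewrite -mul_polyC evM evC mulr_algl. Qed.
Lemma evXn n : ev 'X^n = b ^+ n.
Proof. by rewrite /ev map_polyXn rmorphXn /= horner_algX. Qed.
Lemma ev_comm p q : ev p * ev q = ev q * ev p.
Proof. by rewrite -!evM mulrC. Qed.
Lemma ev_sum (I : Type) (s : seq I) (f : I -> {poly R}) :
  ev (\sum_(i <- s) f i) = \sum_(i <- s) ev (f i).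
Proof. exact: (big_morph ev evD ev0). Qed.

Hypothesis b_sa : star b = b.

Lemma star_ev p : star (ev p) = ev p.
Proof.
elim/poly_ind: p => [|p c IHp]; first by rewrite ev0 (star0 hT).
rewrite evD evM evX evC (starD hT) (starM hT) b_sa IHp (starZ hT) (star1 hT) conjc_real.
by rewrite -{1}evX ev_comm evX.
Qed.

(** A polynomial in two variables is encoded as the list Q of its terms
    p(s) t(X), which act on z by p(b) z t(b).  A diag_step multiplies it by
    1 - k (s - X)^2; diag_bump is thus a power of this polynomial, equal to 1 on
    the diagonal and small away from it. *)
Definition two_sided (Q : seq ({poly R} * {poly R})) z : M :=
  \sum_(i <- Q) ev i.1 * z * ev i.2.

Definition diag_step (k : R) (Q : seq ({poly R} * {poly R})) :=
  Q ++ [seq (- k *: (i.1 * 'X^2), i.2) | i <- Q]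
    ++ [seq (k *+ 2 *: (i.1 * 'X), 'X * i.2) | i <- Q]
    ++ [seq (- k *: i.1, 'X^2 * i.2) | i <- Q].
Definition diag_bump (k : R) n := iter n (diag_step k) [:: (1, 1)].

Definition slice (Q : seq ({poly R} * {poly R})) (s : R) : {poly R} :=
  \sum_(i <- Q) i.1.[s] *: i.2.

Lemma slice_step k Q s : slice (diag_step k Q) s = (1 - k *: (s%:P - 'X) ^+ 2) * slice Q s.
Proof.
rewrite /slice /diag_step !big_cat !big_map /= mulr_sumr -!big_split /=.
apply: eq_bigr => -[p t] _ /=.
have -> : (- k *: (p * 'X^2)).[s] = - k * s * s * p.[s].
  by rewrite hornerZ (hornerM p 'X^2) hornerXn; ring.
have -> : (k *+ 2 *: (p * 'X)).[s] = 2 * k * s * p.[s].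
  by rewrite hornerZ (hornerM p 'X) hornerX; ring.
rewrite hornerZ -!mul_polyC !rmorphM /= !rmorphN /= rmorphMn /=.
ring.
Qed.

Lemma slice_diag_bump k n s (x : R) : (slice (diag_bump k n) s).[x] = (1 - k * (s - x) ^+ 2) ^+ n.
Proof.
elim: n => [|n IHn].
  by rewrite /slice /diag_bump /= big_seq1 /= hornerC scale1r hornerC expr0.
rewrite /diag_bump iterS slice_step hornerM IHn [RHS]exprS; congr (_ * _).
by rewrite hornerD hornerN hornerZ (hornerC 1) horner_exp hornerD hornerN hornerX hornerC.
Qed.

(** This is 1 - k ad_b^2, applied to z. *)
Definition commutator_square (k : R) z :=
  z - k%:C *: (b * (b * z - z * b) - (b * z - z * b) * b).

Lemma two_sided_step k Q z : two_sided (diag_step k Q) z = two_sided Q (commutator_square k z).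
Proof.
rewrite /two_sided /diag_step !big_cat !big_map /= -!big_split /=.
apply: eq_bigr => -[p t] _ /=.
rewrite !evZ !evM !evX /commutator_square.
have -> : b * (b * z - z * b) - (b * z - z * b) * b = b * b * z - b * z * b *+ 2 + z * (b * b).
  rewrite mulrBr mulrBl !mulrA opprB mulr2n opprD -!addrA.
  by congr (_ + _); congr (_ + _); exact: addrC.
move: (ev p) (ev t) => P T.
have expand u v w : P * (z - k%:C *: (u - v *+ 2 + w)) * T =
    P * z * T + (- k)%:C *: (P * u * T) + (k%:C *+ 2) *: (P * v * T) + (- k)%:C *: (P * w * T).
  rewrite mulrBr mulrBl -scalerAr -scalerAl mulrDr mulrBr mulrDl mulrBl mulrnAr mulrnAl.
  rewrite scalerDr scalerBr rmorphN !scaleNr -scalerMnr scalerMnl !opprD opprK !addrA.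
  by [].
rewrite expand rmorphMn /= -!addrA -!scalerAl !mulrA.
by [].
Qed.

Lemma two_sidedD Q x y : two_sided Q (x + y) = two_sided Q x + two_sided Q y.
Proof.
by rewrite /two_sided -big_split; apply: eq_bigr => i _; rewrite mulrDr mulrDl.
Qed.
Lemma two_sidedN Q x : two_sided Q (- x) = - two_sided Q x.
Proof.
by rewrite /two_sided -sumrN; apply: eq_bigr => i _; rewrite mulrN mulNr.
Qed.

Lemma two_sided_diag_bump_comm k n z : b * z = z * b -> two_sided (diag_bump k n) z = z.
Proof.
move=> bz; elim: n => [|n IHn].
  by rewrite /two_sided /diag_bump /= big_seq1 /= ev1 mul1r mulr1.
rewrite /diag_bump iterS two_sided_step (_ : commutator_square k z = z) //.
by rewrite /commutator_square bz subrr mulr0 mul0r subrr scaler0 subr0.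
Qed.

Let ad z := b * z - z * b.

Let ad_symmetric x y : rip (ad x) y = rip x (ad y).
Proof.
rewrite /tau_rip /tau_ip /ad (starB hT) !(starM hT) b_sa; congr complex.Re.
rewrite mulrBr mulrBl !(traceB hT) !mulrA; congr (_ - _).
by rewrite (tauC hT) mulrA.
Qed.

(** The map ad = ad_b is symmetric for the form of the trace, and bounded, so
    that |z - k ad^2 z|^2 = |z|^2 - 2 k |ad z|^2 + k^2 |ad^2 z|^2 <= |z|^2 for
    small k. *)
Lemma commutator_square_contraction : exists2 k0 : R, 0 < k0 & forall k, 0 < k -> k <= k0 ->
  forall z, nsq (commutator_square k z) <= nsq z.
Proof.
have [K1 K1_gt0 bK1] := nsq_mull hT b; have [K2 K2_gt0 bK2] := nsq_mulr hT b.
have adK z : nsq (ad z) <= (2 * K1 + 2 * K2) * nsq z.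
  apply: le_trans (nsqD hT _ _) _; rewrite (nsqN hT).
  by have := bK1 z; have := bK2 z; move: (nsq z) (nsq (b * z)) (nsq (z * b)) => u v w; lra.
exists (K1 + K2)^-1; first by rewrite invr_gt0 addr_gt0.
move=> k k_gt0; rewrite -[k in k <= _]invrK lef_pV2 ?posrE ?invr_gt0 ?addr_gt0 // => kK z.
have {}kK : k * (K1 + K2) <= 1 by rewrite -ler_pdivlMl // mulr1.
have -> : commutator_square k z = z - k%:C *: ad (ad z) by [].
have := adK (ad z); have : rip z (ad (ad z)) = nsq (ad z) by rewrite -ad_symmetric.
move: (nsq (ad z)) (nsq_ge0 hT (ad z)) (ad (ad z)) => v v0 w.
rewrite /tau_nsq !(ripE hT) (ripC hT w z) => ->.
move: (rip z z) (rip w w) => u {}w wv.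
have : k ^+ 2 * w <= k ^+ 2 * ((2 * K1 + 2 * K2) * v) by rewrite ler_pM2l ?exprn_gt0.
have : k * (K1 + K2) * (k * v) <= 1 * (k * v) by rewrite ler_wpM2r // mulr_ge0 // ltW.
by lra.
Qed.

Lemma two_sided_diag_bump_contraction : exists2 k0 : R, 0 < k0 & forall k, 0 < k -> k <= k0 ->
  forall n z, nsq (two_sided (diag_bump k n) z) <= nsq z.
Proof.
have [k0 k0_gt0 contr] := commutator_square_contraction; exists k0 => // k k_gt0 kk0.
elim=> [|n IHn] z.
  by rewrite /two_sided /diag_bump /= big_seq1 /= ev1 mul1r mulr1.
rewrite /diag_bump iterS two_sided_step; apply: le_trans (IHn _) _; exact: contr.
Qed.

Variables (mu : probability (measurableTypeR R) R) (r : R).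
Hypothesis mu_r : mu [set x : R | - r <= x <= r] = 1%E.
Hypothesis mu_diffuse : forall t : R, mu [set t] = 0%E.
Hypothesis mu_tau : forall n : nat, tau (b ^+ n) = (\int[mu]_x (x ^+ n))%:C.
Local Notation moment := (moment mu).

Lemma tau_ev p : tau (ev p) = (moment p)%:C.
Proof.
have mD p1 p2 : moment (p1 + p2) = moment p1 + moment p2.
  by have := moment_linear mu_r 1 p1 p2; rewrite scale1r mul1r.
have m0 : moment 0 = 0 by apply: (addrI (moment 0)); rewrite -mD !addr0.
have mZ c p1 : moment (c *: p1) = c * moment p1.
  by have := moment_linear mu_r c p1 0; rewrite m0 !addr0.
rewrite -[p]coefK poly_def ev_sum (trace_sum hT) (big_morph _ mD m0) rmorph_sum /=.
apply: eq_bigr => i _; rewrite evZ evXn (traceZ hT) mu_tau mZ rmorphM; congr (_ * _%:C).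
by apply: eq_Rintegral => x _; rewrite hornerXn.
Qed.

Lemma nsq_ev p : nsq (ev p) = moment (p ^+ 2).
Proof. by rewrite /tau_nsq /tau_rip /tau_ip star_ev -evM -expr2 tau_ev. Qed.

Definition pairing (al be : M) (Q : seq ({poly R} * {poly R})) : C :=
  \sum_(i <- Q) tau (ev i.1 * al) * tau (ev i.2 * be).

(** The squared modulus of tau (Q(s, b) be), as a polynomial in s. *)
Let majorant be Q : {poly R} :=
  (\sum_(i <- Q) complex.Re (tau (ev i.2 * be)) *: i.1) ^+ 2 +
  (\sum_(i <- Q) complex.Im (tau (ev i.2 * be)) *: i.1) ^+ 2.

Let horner_majorant be Q s : (majorant be Q).[s] = normsq (tau (ev (slice Q s) * be)).
Proof.
rewrite /majorant hornerD !horner_exp !horner_sum /slice ev_sum mulr_suml (trace_sum hT).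
rewrite /normsq !raddf_sum /=; congr (_ ^+ 2 + _ ^+ 2); apply: eq_bigr => i _;
  rewrite hornerZ evZ -scalerAl (traceZ hT); case: (tau _) => u v /=; ring.
Qed.

(** The pairing is tau (U al) for U = u(b) + i v(b), and the integral of
    u^2 + v^2 is the squared norm of U. *)
Let pairing_le al be Q : normsq (pairing al be Q) <= moment (majorant be Q) * nsq al.
Proof.
pose u := \sum_(i <- Q) complex.Re (tau (ev i.2 * be)) *: i.1.
pose v := \sum_(i <- Q) complex.Im (tau (ev i.2 * be)) *: i.1.
have -> : pairing al be Q = tau ((ev u + 'i%C *: ev v) * al).
  rewrite /pairing /u /v !ev_sum scaler_sumr -big_split mulr_suml (trace_sum hT).
  apply: eq_bigr => i _ /=; rewrite !evZ scalerA -scalerDl -complexE -scalerAl (traceZ hT).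
  by rewrite mulrC.
apply: le_trans (trace_CS hT _ _) _.
suff -> : nsq (ev u + 'i%C *: ev v) = moment (majorant be Q) by [].
rewrite /tau_nsq /tau_rip /tau_ip (starD hT) (starZ hT) !star_ev.
have -> : (ev u + ('i%C : C)^*%C *: ev v) * (ev u + 'i%C *: ev v) = ev (u ^+ 2 + v ^+ 2).
  have -> : ('i%C : C)^*%C = - 'i%C by apply/eqP; rewrite eq_complex /= oppr0 !eqxx.
  rewrite evD !expr2 !evM mulrDl !mulrDr -!scalerAl -!scalerAr scalerA (ev_comm v u).
  have -> : - 'i%C * 'i%C = 1 :> C.
    by apply/eqP; rewrite eq_complex /=; apply/andP; split; apply/eqP; ring.
  by rewrite scale1r scaleNr addrA addrK.
by rewrite tau_ev.
Qed.

(** A bilinear functional of the form (p, q) -> tau (p(b) al) tau (q(b) be) is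
    bounded by the norm of L^2(mu x mu).  The functions (1 - k (s - t)^2)^n
    decrease to the indicator function of the diagonal, which is a null set
    since mu has no atoms. *)
Lemma pairing_diag_bump_cvg0 (k : R) al be : 0 < k -> k * (2 * r) ^+ 2 <= 1 ->
  forall e : R, 0 < e -> exists N, forall n, (N <= n)%N ->
    normsq (pairing al be (diag_bump k n)) <= e.
Proof.
move=> k_gt0 kr e e_gt0.
have bound_base (s x : R) : - r <= s <= r -> - r <= x <= r ->
    0 <= 1 - k * (s - x) ^+ 2 <= 1.
  move=> /andP[s1 s2] /andP[x1 x2].
  have h : (s - x) ^+ 2 <= (2 * r) ^+ 2.
    rewrite -subr_ge0; have -> : (2 * r) ^+ 2 - (s - x) ^+ 2 =
      (2 * r - (s - x)) * (2 * r + (s - x)) by ring.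
    by rewrite mulr_ge0 //; lra.
  rewrite subr_ge0 gerBl (le_trans _ kr) ?ler_pM2l //=.
  by rewrite mulr_ge0 ?sqr_ge0 // ltW.
have bound (s x : R) n : - r <= s <= r -> - r <= x <= r ->
    0 <= ((slice (diag_bump k n) s) ^+ 2).[x] <= 1.
  move=> sr xr; rewrite horner_exp slice_diag_bump sqr_ge0 /=.
  by have /andP[? ?] := bound_base _ _ sr xr; rewrite -exprM exprn_ile1.
(* In the second variable, convergence fails at x = s only. *)
have inner s : - r <= s <= r ->
    (fun n => moment ((slice (diag_bump k n) s) ^+ 2)) @ \oo --> (0 : R).
  move=> sr; apply: (moment_cvg0 mu_r (K := 1) (mu_diffuse s)).
    by move=> n x xr; exact: bound.
  move=> x xr xs.
  have -> : (fun n => (slice (diag_bump k n) s ^+ 2).[x]) =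
      (fun n => ((1 - k * (s - x) ^+ 2) ^+ 2) ^+ n).
    by apply/funext => n; rewrite horner_exp slice_diag_bump exprAC.
  apply: cvg_expr; rewrite ger0_norm ?sqr_ge0 //.
  have /andP[b0 b1] := bound_base _ _ sr xr.
  rewrite expr_lte1 // ltrBlDr ltrDl mulr_gt0 // exprn_even_gt0 //= subr_eq0.
  by rewrite eq_sym.
have moment1 : moment 1 = 1.
  by apply: complexI; rewrite -tau_ev ev1 (tau1 hT).
have majorant_le s n : (majorant be (diag_bump k n)).[s] <=
    moment (slice (diag_bump k n) s ^+ 2) * nsq be.
  by rewrite horner_majorant; apply: le_trans (trace_CS hT _ _) _; rewrite nsq_ev.
have : (fun n => moment (majorant be (diag_bump k n))) @ \oo --> (0 : R).
  apply: (moment_cvg0 mu_r (K := nsq be) (mu_diffuse 0)).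
    move=> n s sr; rewrite {1}horner_majorant normsq_ge0 /=.
    apply: le_trans (majorant_le s n) _; rewrite -[leRHS]mul1r ler_wpM2r ?nsq_ge0 //.
    rewrite -moment1; apply: (moment_le mu_r) => x xr; rewrite hornerC.
    by have /andP[] := bound s x n sr xr.
  move=> s sr _.
  apply: (@squeeze_cvgr _ _ _ _ (fun=> 0) (fun n => moment (slice (diag_bump k n) s ^+ 2) * nsq be)).
  - by apply: nearW => n; rewrite {1}horner_majorant normsq_ge0 /=.
  - exact: cvg_cst.
  - by rewrite -[0 in X in _ --> X](mul0r (nsq be)); apply: cvgMl; exact: inner.
move=> /cvgrPdist_le /(_ (e / (nsq al + 1))) [|N _ NP].
  by rewrite divr_gt0 // ltr_wpDl // nsq_ge0.
exists N => n /NP /=; rewrite sub0r normrN => mn.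
apply: le_trans (pairing_le _ _ _) _.
have al1 : 0 < nsq al + 1 by rewrite ltr_wpDl // nsq_ge0.
apply: le_trans (_ : _ <= (e / (nsq al + 1)) * (nsq al + 1)) _; last by rewrite divfK // gt_eqF.
apply: le_trans (_ : _ <= (e / (nsq al + 1)) * nsq al) _.
  by rewrite ler_wpM2r ?nsq_ge0 //; apply: le_trans mn; exact: ler_norm.
by rewrite ler_pM2l ?divr_gt0 // lerDl.
Qed.

End PolynomialCalculus.

(** * Central elements are scalar *)

Section CentralElements.
Context {R : realType} {M : algType R[i]} {star : M -> M} {tau : M -> R[i]}.
Hypothesis hT : tracial_star_algebra star tau.
Local Notation C := (R[i]).
Local Notation nsq := (@tau_nsq R M star tau).
Local Notation pairing := (@pairing R M tau).

Context {A : algType C} (iota : {lrmorphism A -> M}).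
Variable d : A -> tensor A A.
Hypothesis d_linear : linear d.
Hypothesis d_leibniz : forall a b, d (a * b) = tensor_lact a (d b) + tensor_ract (d a) b.

Let dD a b : d (a + b) = d a + d b. Proof. exact: linear_additive. Qed.
Let dN a : d (- a) = - d a.
Proof. by rewrite -[- a]scaleN1r (linear_scale _ _ d_linear) scaleN1r. Qed.
Let d0 : d 0 = 0. Proof. exact: linear_zero. Qed.

(** These functionals see the tensor d z through numbers that remain bounded
    when z approaches an element outside the domain of d. *)
Definition contract (x y : M) (t : tensor A A) : C^o :=
  tensor_lift (fun a b => tau (x * iota a) * tau (iota b * y) : C^o) t.

Let contract_fl (x y : M) (v : A) : linear (fun u : A => tau (x * iota u) * tau (iota v * y) : C^o).
Proof.
move=> c u u'; rewrite linearP mulrDr -scalerAr (tauP hT) mulrDl; congr (_ + _).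
by rewrite -mulrA.
Qed.
Let contract_fr (x y : M) (u : A) : linear (fun v : A => tau (x * iota u) * tau (iota v * y) : C^o).
Proof.
move=> c v v'; rewrite linearP mulrDl -scalerAl (tauP hT) mulrDr; congr (_ + _).
by rewrite mulrCA.
Qed.

Lemma contract_linear x y : linear (contract x y).
Proof. by apply: tensor_lift_linear => [v|u]; [exact: contract_fl|exact: contract_fr]. Qed.
Lemma contract_tens x y a b : contract x y (tens a b) = tau (x * iota a) * tau (iota b * y).
Proof. by apply: tensor_lift_tens => [v|u]; [exact: contract_fl|exact: contract_fr]. Qed.
Lemma contractD x y s t : contract x y (s + t) = contract x y s + contract x y t.
Proof. exact: (linear_additive _ _ (contract_linear x y)). Qed.

Lemma contractN x y t : contract x y (- t) = - contract x y t.
Proof. by rewrite -scaleN1r (linear_scale _ _ (contract_linear x y)) scaleN1r. Qed.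

Lemma contract_lact x y a t : contract x y (tensor_lact a t) = contract (x * iota a) y t.
Proof.
move: t; apply: tensor_eq_linear; last first.
- by move=> b c; rewrite lact_tens !contract_tens rmorphM mulrA.
- exact: contract_linear.
- by apply: (linear_compose (contract_linear x y)); exact: lact_linear.
Qed.
Lemma contract_ract x y t b : contract x y (tensor_ract t b) = contract x (iota b * y) t.
Proof.
move: t; apply: tensor_eq_linear; last first.
- by move=> a c; rewrite ract_tens !contract_tens rmorphM mulrA.
- exact: contract_linear.
- by apply: (linear_compose (contract_linear x y)); exact: ract_linear.
Qed.

(* This bound is what a conjugate variable provides. *)
Variable K0 : R.
Hypothesis conjugate_bound : forall a, normsq (contract 1 1 (d a)) <= K0 * nsq (iota a).

Let dominated (f : A -> C) := exists K : R, forall z, normsq (f z) <= K * nsq (iota z).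

Let dominatedD f g : dominated f -> dominated g -> dominated (fun z => f z + g z).
Proof.
move=> [K fK] [L gL]; exists (2 * K + 2 * L) => z.
apply: le_trans (normsqD _ _) _; have := fK z; have := gL z.
by move: (normsq _) (normsq _) (nsq _) => u v w; lra.
Qed.
Let dominatedN f : dominated f -> dominated (fun z => - f z).
Proof. by move=> [K fK]; exists K => z; rewrite normsqN. Qed.
Let dominated_trace (x y : M) (c : C) : dominated (fun z => tau (x * iota z * y) * c).
Proof.
exists (normsq c * nsq (y * x)) => z.
have -> : tau (x * iota z * y) = tau (iota z * (y * x)).
  by rewrite -mulrA (tauC hT) mulrA.
rewrite normsqM mulrC -[leRHS]mulrA ler_wpM2l ?normsq_ge0 // [leRHS]mulrC.
exact: (trace_CS hT).
Qed.
Let dominated_sum (I : Type) (s : seq I) (f : I -> A -> C) :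
  (forall i, dominated (f i)) -> dominated (fun z => \sum_(i <- s) f i z).
Proof.
move=> fK; elim: s => [|i s IHs].
  by exists 0 => z; rewrite big_nil mul0r /normsq /= expr0n addr0.
have [K sK] := dominatedD (fK i) IHs; exists K => z; rewrite big_cons; exact: sK.
Qed.

(** By the Leibniz rule contract x y (d z) is contract 1 1 (d (x z y)), up to
    two terms in which z is not differentiated. *)
Lemma contract_d_dominated (x y : A) :
  exists K : R, forall z, normsq (contract (iota x) (iota y) (d z)) <= K * nsq (iota z).
Proof.
suff: dominated (fun z => contract 1 1 (d (x * z * y))
    + - contract (iota x * iota z) 1 (d y) + - contract 1 (iota z * iota y) (d x)).
  move=> [K KP]; exists K => z; apply: le_trans (KP z); rewrite le_eqVlt; apply/orP; left.
  apply/eqP; congr normsq; rewrite !d_leibniz.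
  rewrite (linear_additive _ _ (ract_linear _)) !contractD !contract_lact !contract_ract.
  rewrite contract_lact !rmorphM !mul1r !mulr1.
  by rewrite [contract (iota x * iota z) 1 (d y) + _]addrC !addrK.
apply: dominatedD; first apply: dominatedD.
- have [L1 L1_gt0 xL] := nsq_mull hT (iota x); have [L2 L2_gt0 yL] := nsq_mulr hT (iota y).
  exists (`|K0| * (L2 * L1)) => z; apply: le_trans (conjugate_bound _) _.
  apply: le_trans (_ : _ <= `|K0| * nsq (iota (x * z * y))) _.
    by rewrite ler_wpM2r ?nsq_ge0 // ler_norm.
  rewrite -[leRHS]mulrA ler_wpM2l // !rmorphM; apply: le_trans (yL _) _.
  by rewrite -[leRHS]mulrA ler_wpM2l // ltW.
- apply: dominatedN; apply: dominated_sum => i.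
  by have [K KP] := dominated_trace (iota x) (iota i.1) (tau (iota i.2 * 1)); exists K.
- apply: dominatedN; apply: dominated_sum => i.
  have [K KP] := dominated_trace (iota i.2) (iota y) (tau (1 * iota i.1)); exists K => z.
  by rewrite mulrC mulrA; exact: KP.
Qed.


Variable b : A.
Hypothesis b_sa : star (iota b) = iota b.
Hypothesis db : d b = 0.
Variables (mu : probability (measurableTypeR R) R) (r : R).
Hypothesis mu_r : mu [set x : R | - r <= x <= r] = 1%E.
Hypothesis mu_diffuse : forall t : R, mu [set t] = 0%E.
Hypothesis mu_tau : forall n : nat, tau (iota b ^+ n) = (\int[mu]_x (x ^+ n))%:C.

Variable Z : M.
Hypothesis Z_central : forall a, Z * iota a = iota a * Z.

Let dM0l a z : d a = 0 -> d (a * z) = tensor_lact a (d z).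
Proof. by move=> da; rewrite d_leibniz da (linear_zero (ract_linear _)) addr0. Qed.
Let dM0r a z : d a = 0 -> d (z * a) = tensor_ract (d z) a.
Proof. by move=> da; rewrite d_leibniz da (linear_zero (lact_linear _)) add0r. Qed.

Let d_ev p : d (ev b p) = 0.
Proof.
elim/poly_ind: p => [|p c IHp]; first by rewrite ev0 d0.
rewrite evD evM evX evC dD dM0l // db (linear_zero (lact_linear _)) add0r.
have d1 : d 1 = 0.
  apply: (addrI (d 1)); rewrite addr0 -{3}[1]mulr1 d_leibniz lact1 ract1 //.
by rewrite (linear_scale _ _ d_linear) d1 scaler0.
Qed.

Let iota_ev p : iota (ev b p) = ev (iota b) p.
Proof.
elim/poly_ind: p => [|p c IHp]; first by rewrite !ev0 rmorph0.
by rewrite !evD !evM !evX !evC rmorphD rmorphM /= IHp linearZ /= rmorph1.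
Qed.

Let iota_two_sided Q z : iota (two_sided b Q z) = two_sided (iota b) Q (iota z).
Proof.
by rewrite /two_sided rmorph_sum; apply: eq_bigr => i _; rewrite !rmorphM /= !iota_ev.
Qed.

Let contract_two_sided (x y : M) Q z : contract x y (d (two_sided b Q z)) =
  \sum_(i <- repr (d z)) pairing (iota b) (iota i.1 * x) (y * iota i.2) Q.
Proof.
rewrite /two_sided (big_morph d dD d0).
rewrite (big_morph (contract x y) (contractD x y) (linear_zero (contract_linear x y))).
rewrite exchange_big /=; apply: eq_bigr => q _.
rewrite dM0r ?dM0l ?d_ev // contract_ract contract_lact /contract /tensor_lift.
apply: eq_bigr => i _; rewrite !iota_ev; congr (_ * _).
  by rewrite -mulrA (tauC hT) -mulrA.
by rewrite (tauC hT) -mulrA.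
Qed.

Let pairing_sum_cvg0 (k : R) (I : Type) (s : seq I) (al be : I -> M) :
  0 < k -> k * (2 * r) ^+ 2 <= 1 -> forall e : R, 0 < e -> exists N, forall n, (N <= n)%N ->
    normsq (\sum_(i <- s) pairing (iota b) (al i) (be i) (diag_bump k n)) <= e.
Proof.
move=> k_gt0 kr; elim: s => [|i s IHs] e e_gt0.
  by exists 0%N => n _; rewrite big_nil /normsq /= expr0n addr0 ltW.
have e4 : 0 < e / 4 by rewrite divr_gt0.
have [N NP] := pairing_diag_bump_cvg0 hT b_sa mu_r mu_diffuse mu_tau (al i) (be i) k_gt0 kr e4.
have [N' NP'] := IHs _ e4; exists (maxn N N') => n; rewrite geq_max => /andP[/NP h /NP' h'].
rewrite big_cons; apply: le_trans (normsqD _ _) _.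
by move: h h'; move: (normsq _) (normsq _) => u v; lra.
Qed.

(** The contractions attached to the polynomials diag_bump fix Z, which commutes
    with b, and hence move z by at most twice its distance to Z.  On the other
    hand they take contract x y (d z) to 0. *)
Lemma contract_d_near_central (x y : A) : exists K : R, forall z,
  normsq (contract (iota x) (iota y) (d z)) <= K * nsq (Z - iota z).
Proof.
have [K KP] := contract_d_dominated x y.
have [k0 k0_gt0 contraction] := two_sided_diag_bump_contraction hT b_sa.
pose k : R := Num.min k0 ((2 * r) ^+ 2 + 1)^-1.
have k_gt0 : 0 < k by rewrite lt_min k0_gt0 invr_gt0 ltr_wpDl ?sqr_ge0.
have kr : k * (2 * r) ^+ 2 <= 1.
  apply: le_trans (_ : _ <= ((2 * r) ^+ 2 + 1)^-1 * (2 * r) ^+ 2) _.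
    by rewrite ler_wpM2r ?sqr_ge0 // ge_min lexx orbT.
  by rewrite ler_pdivrMl ?ltr_wpDl ?sqr_ge0 // mulr1 lerDl.
exists (8 * `|K|) => z; apply/ler_addgt0Pr => e e_gt0.
have e2 : 0 < e / 2 by rewrite divr_gt0.
have [N /(_ N (leqnn N))] := pairing_sum_cvg0 (repr (d z)) (fun i => iota i.1 * iota x)
  (fun i => iota y * iota i.2) k_gt0 kr e2.
rewrite -contract_two_sided; set w := two_sided b (diag_bump k N) z => wN.
have wZ : nsq (iota (z - w)) <= 4 * nsq (Z - iota z).
  have -> : iota (z - w) = two_sided (iota b) (diag_bump k N) (Z - iota z) + - (Z - iota z).
    rewrite rmorphB /= /w iota_two_sided two_sidedD two_sidedN.
    have ZK : two_sided (iota b) (diag_bump k N) Z = Z by apply: two_sided_diag_bump_comm; rewrite Z_central.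
    by rewrite ZK opprB [RHS]addrC addrA subrK.
  apply: le_trans (nsqD hT _ _) _; rewrite (nsqN hT).
  have := contraction k k_gt0 _ N (Z - iota z); rewrite ge_min lexx => /(_ isT).
  by move: (nsq _) (nsq _) => u v; lra.
have -> : d z = d w + d (z - w) by rewrite -dD addrC subrK.
rewrite contractD; apply: le_trans (normsqD _ _) _.
have := KP (z - w).
have : K * nsq (iota (z - w)) <= `|K| * (4 * nsq (Z - iota z)).
  apply: le_trans (_ : _ <= `|K| * nsq (iota (z - w))) _.
    by rewrite ler_wpM2r ?nsq_ge0 // ler_norm.
  by rewrite ler_wpM2l.
move: wN; move: (normsq _) (normsq _) (K * _) => u v c.
by move: (`|K|) (nsq (Z - iota z)) => K' s; lra.
Qed.

Variable X : A.
Hypothesis dX : d X = tens 1 1.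
Hypothesis Z_approx : forall e : R, 0 < e -> exists z, nsq (Z - iota z) < e.
Hypothesis Zstar_approx : forall e : R, 0 < e -> exists z, nsq (star Z - iota z) < e.

Let small_limit (c : C) (K : R) :
  (forall z, normsq c <= K * nsq (Z - iota z)) -> c = 0.
Proof.
move=> cK; apply: normsq_small => e e_gt0.
have K1 : 0 < `|K| + 1 by rewrite ltr_wpDl.
have [z zE] := Z_approx (divr_gt0 e_gt0 K1).
apply: le_trans (cK z) _; apply: le_trans (_ : _ <= (`|K| + 1) * nsq (Z - iota z)) _.
  rewrite ler_wpM2r ?nsq_ge0 //; apply: le_trans (ler_norm K) _; by rewrite lerDl.
by rewrite mulrC -ler_pdivlMr // ltW.
Qed.

(** In d [z, X] = (d z) X - X (d z) + z (x) 1 - 1 (x) z every term but the last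
    two is small when z is near Z. *)
Lemma trace_central y : tau Z * tau (iota y) = tau (Z * iota y).
Proof.
have [K1 z1] := contract_d_near_central 1 (X * y).
have [K2 z2] := contract_d_near_central X y.
have [K3 z3] := contract_d_dominated 1 y.
have [L1 L1_gt0 XL] := nsq_mull hT (iota X); have [L2 L2_gt0 XR] := nsq_mulr hT (iota X).
pose K4 := 2 * nsq (star 1) * normsq (tau (iota y)) + 2 * nsq (iota y).
apply/eqP; rewrite -subr_eq0; apply/eqP.
apply: (small_limit (K := 2 * (2 * (2 * K1 + 2 * K2) + 2 * (`|K3| * (2 * L1 + 2 * L2))) + 2 * K4)) => z.
have -> : tau Z * tau (iota y) - tau (Z * iota y) =
   (tau (iota z) * tau (iota y) - tau (iota z * iota y)) +
   (tau (Z - iota z) * tau (iota y) - tau ((Z - iota z) * iota y)).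
  by rewrite mulrBl !(traceB hT); ring.
apply: le_trans (normsqD _ _) _; rewrite [leRHS]mulrDl; apply: lerD; last first.
  rewrite -[leRHS]mulrA ler_pM2l //; apply: le_trans (normsqD _ _) _.
  rewrite normsqN normsqM /K4 [leRHS]mulrDl -![2 * _ * _]mulrA; apply: lerD; rewrite ler_pM2l //.
    rewrite [leRHS]mulrAC ler_wpM2r ?normsq_ge0 //.
    by have := ip_CS hT (Z - iota z) (star 1); rewrite /tau_ip (starK hT) mul1r mulrC.
  by rewrite mulrC; exact: (trace_CS hT).
rewrite -[leRHS]mulrA ler_pM2l //.
have -> : tau (iota z) * tau (iota y) - tau (iota z * iota y) =
   contract (iota X) (iota y) (d z) - contract (iota 1) (iota (X * y)) (d z)
    + contract (iota 1) (iota y) (d (z * X - X * z)).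
  rewrite dD dN !d_leibniz dX !lact_tens !ract_tens !contractD contractN !contractD.
  rewrite contract_ract contract_lact !contract_tens !rmorphM !rmorph1 !mul1r !mulr1 (tau1 hT) mul1r.
  have rearrange (c1 c2 c3 c4 : C) : c3 - c4 = c1 - c2 + (c3 + c2 - (c1 + c4)) by ring.
  exact: rearrange.
have comm : nsq (iota (z * X - X * z)) <= (2 * L1 + 2 * L2) * nsq (Z - iota z).
  have -> : iota (z * X - X * z) = iota X * (Z - iota z) + - ((Z - iota z) * iota X).
    by rewrite rmorphB !rmorphM mulrBr mulrBl Z_central opprB [RHS]addrC addrA subrK.
  apply: le_trans (nsqD hT _ _) _; rewrite (nsqN hT).
  by have := XL (Z - iota z); have := XR (Z - iota z); lra.
have z12 : normsq (contract (iota X) (iota y) (d z) - contract (iota 1) (iota (X * y)) (d z))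
    <= (2 * K1 + 2 * K2) * nsq (Z - iota z).
  apply: le_trans (normsqD _ _) _; rewrite normsqN.
  by have := z1 z; have := z2 z; lra.
have z3' : normsq (contract (iota 1) (iota y) (d (z * X - X * z))) <=
    `|K3| * (2 * L1 + 2 * L2) * nsq (Z - iota z).
  apply: le_trans (z3 _) _; rewrite -[leRHS]mulrA.
  apply: le_trans (_ : _ <= `|K3| * nsq (iota (z * X - X * z))) _.
    by rewrite ler_wpM2r ?(nsq_ge0 hT) // ler_norm.
  by rewrite ler_wpM2l.
apply: le_trans (normsqD _ _) _; rewrite [leRHS]mulrDl -![in leRHS]mulrA.
by apply: lerD; rewrite ler_pM2l // mulrA.
Qed.

(** The element W = Z - tau Z satisfies tau (W y) = 0 for y in A, hence also for
    y = W*, which is a limit of elements of A. *)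
Theorem central_scalar : Z = (tau Z)%:A.
Proof.
apply/eqP; rewrite -subr_eq0; apply/eqP.
set W := Z - _.
have W_orth y : tau (W * iota y) = 0.
  by rewrite /W mulrBl (traceB hT) mulr_algl (traceZ hT) -trace_central subrr.
rewrite -[W](starK hT) (_ : star W = 0) ?(star0 hT) //.
apply: (nsq_eq0 hT); rewrite /tau_nsq /tau_rip /tau_ip (starK hT).
suff -> : tau (W * star W) = 0 by [].
apply: normsq_small => e e_gt0.
have W1 : 0 < nsq W + 1 by rewrite ltr_wpDl ?(nsq_ge0 hT).
have [w wE] := Zstar_approx (divr_gt0 e_gt0 W1).
have -> : tau (W * star W) = tau (W * (star Z - iota w)).
  have -> : star W = (star Z - iota w) + iota (w - (tau Z)^*%C%:A).
    rewrite rmorphB /= linearZ /= rmorph1 /W (starB hT) (starZ hT) (star1 hT).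
    by rewrite addrA subrK.
  by rewrite mulrDr (traceD hT) W_orth addr0.
apply: le_trans (trace_CS hT _ _) _.
apply: le_trans (_ : _ <= (nsq W + 1) * nsq (star Z - iota w)) _.
  by rewrite ler_wpM2r ?(nsq_ge0 hT) // lerDl.
by rewrite mulrC -ler_pdivlMr // ltW.
Qed.
End CentralElements.

(** * Von Neumann algebras with a tracial state *)

Section CommutantAlgebra.
Context {R : realType} {H : hilbertType R}.

Definition commutant_pred (S : set (bop H)) : {pred bop H} := [pred x | `[< commutant S x >]].

Fact commutant_subalg_closed (S : set (bop H)) : subalg_closed (commutant_pred S).
Proof.
split=> [|c x y /asboolP xS /asboolP yS|x y /asboolP xS /asboolP yS]; apply/asboolP => s Ss.
- by rewrite mul1r mulr1.
- by rewrite mulrDl mulrDr -scalerAl -scalerAr xS // yS.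
- by rewrite -mulrA yS // mulrA xS // mulrA.
Qed.
HB.instance Definition _ (S : set (bop H)) :=
  GRing.isSubalgClosed.Build R[i] (bop H) (commutant_pred S) (commutant_subalg_closed S).

End CommutantAlgebra.

Lemma adjoin_ind (K : fieldType) (A : algType K) (B : {pred A}) (X : A) (P : A -> Prop) :
  P 1 -> (forall c u v, P u -> P v -> P (c *: u + v)) ->
  (forall u v, P u -> P v -> P (u * v)) -> (forall b, b \in B -> P b) -> P X ->
  forall a, a \in adjoin B X -> P a.
Proof.
move=> P1 Plin Pmul PB PX a /asboolP aS.
pose Q : {pred A} := fun x => `[< P x >].
have Pcl : subalg_closed Q.
  split=> [|c u v /asboolP uP /asboolP vP|u v /asboolP uP /asboolP vP]; apply/asboolP => //.
    exact: Plin.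
  exact: Pmul.
pose S := HB.pack_for (subalgClosed A) Q (GRing.isSubalgClosed.Build K A Q Pcl).
have /asboolP : a \in S by apply: aS => [b bB|]; apply/asboolP => //; exact: PB.
by [].
Qed.

Lemma subset_adjoin (K : fieldType) (A : algType K) (B : {pred A}) (X b : A) :
  b \in B -> b \in adjoin B X.
Proof. by move=> bB; apply/asboolP => S BS _; exact: BS. Qed.
Lemma mem_adjoin (K : fieldType) (A : algType K) (B : {pred A}) (X : A) : X \in adjoin B X.
Proof. by apply/asboolP. Qed.

Section GeneratedAlgebra.
Context {R : realType} {H : hilbertType R}.
Variables (X : bop H) (B : subalgClosed (bop H)).
Hypothesis X_sa : adjoint X = X.
Hypothesis B_star : forall b : bop H, b \in B -> adjoint b \in B.

Lemma adjoin_adjoint : adjoint_closed [set a | a \in adjoin B X].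
Proof.
move=> a /= aA; apply: (adjoin_ind (P := fun a => adjoint a \in adjoin B X)) aA.
- by rewrite adjoint1; exact: rpred1.
- by move=> c u v uA vA; rewrite adjointD adjointZ rpredD // rpredZ.
- by move=> u v uA vA; rewrite adjointM rpredM.
- by move=> b /B_star; exact: subset_adjoin.
- by rewrite X_sa mem_adjoin.
Qed.

Lemma von_neumann_adjoin N : von_neumann_algebra N -> N X -> (forall b, b \in B -> N b) ->
  forall a, a \in adjoin B X -> N a.
Proof.
move=> [_ NE] NX NB a aA; rewrite -NE; apply/asboolP.
change (a \in commutant_pred (commutant N)).
have mem x : N x -> x \in commutant_pred (commutant N) by rewrite -{1}NE => ?; exact/asboolP.
move: aA => /asboolP; apply; last exact: mem.
by move=> b /NB; exact: mem.
Qed.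

(** A von Neumann algebra that contains X and B is its own double commutant, and
    so contains that of the algebra generated by X and B. *)
Lemma Wstar_double_commutant :
  Wstar X B = commutant (commutant [set a | a \in adjoin B X]).
Proof.
apply/seteqP; split=> T.
  apply; first exact: double_commutant_von_neumann adjoin_adjoint.
    by apply: double_commutant_sup; exact: mem_adjoin.
  by move=> b bB; apply: double_commutant_sup; exact: subset_adjoin.
move=> TA N N_vn NX NB; have [_ <-] := N_vn.
move: T TA; apply: commutant_anti; apply: commutant_anti.
by move=> a /= aA; exact: (von_neumann_adjoin N_vn).
Qed.

End GeneratedAlgebra.

Section TracialInstance.
Context {R : realType} {H : hilbertType R} (M : set (bop H)) (tau : bop H -> R[i]).
Hypothesis hM : tracial_Wstar_probability_space M tau.
Local Notation C := (R[i]).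

(** M, as the commutant of its commutant: a form in which it is an algebra
    without further hypotheses. *)
Definition vn_type := subalg (commutant_pred (commutant M)).
HB.instance Definition _ := GRing.Algebra.on vn_type.

Lemma vnP (x : vn_type) : M (val x).
Proof.
have [_ ME] := tW_von_neumann hM; have /asboolP := valP x.
by move: (val x) => T TM; rewrite -ME.
Qed.
Lemma mem_vn T : M T -> T \in commutant_pred (commutant M).
Proof. by have [_ ME] := tW_von_neumann hM; move=> TM; apply/asboolP; rewrite ME. Qed.

Definition vn T (TM : M T) : vn_type := Sub T (mem_vn TM).

Lemma vn_star_subproof (x : vn_type) : M (adjoint (val x)).
Proof. by have [adjM _] := tW_von_neumann hM; apply: adjM; exact: vnP. Qed.
Definition vn_star (x : vn_type) : vn_type := vn (vn_star_subproof x).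
Lemma vn_starE x : val (vn_star x) = adjoint (val x).
Proof. exact: SubK. Qed.
Lemma vn_valM (x y : vn_type) : val (x * y) = val x * val y.
Proof. by []. Qed.
Lemma vn_valX (x : vn_type) n : val (x ^+ n) = val x ^+ n.
Proof. by elim: n => // n IHn; rewrite !exprS vn_valM IHn. Qed.
Definition vn_tau (x : vn_type) : C := tau (val x).

Lemma operator_bound_mul (S T : bop H) (k l : R) :
  (forall u, rdot (S u) (S u) <= k ^+ 2 * rdot u u) ->
  (forall u, rdot (T u) (T u) <= l ^+ 2 * rdot u u) ->
  forall u, rdot ((S * T) u) ((S * T) u) <= (k * l) ^+ 2 * rdot u u.
Proof.
move=> Sk Tl u; apply: le_trans (Sk _) _; rewrite exprMn -[leRHS]mulrA.
by rewrite ler_wpM2l ?sqr_ge0.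
Qed.

Lemma operator_bound_exists (T : bop H) : exists2 k : R, 0 < k &
  forall u, rdot (T u) (T u) <= k ^+ 2 * rdot u u.
Proof.
have [K K0 TK] := bop_bounded T; exists (Num.sqrt K); first by rewrite sqrtr_gt0.
by rewrite sqr_sqrtr // ltW.
Qed.

(** The growth bound holds because bounds of operators multiply. *)
Lemma vn_tracial : tracial_star_algebra vn_star vn_tau.
Proof.
split.
- by move=> x y; apply: val_inj; exact: adjointD.
- by move=> c x; apply: val_inj; exact: adjointZ.
- by move=> x y; apply: val_inj; exact: adjointM.
- by move=> x; apply: val_inj; exact: adjointK.
- by move=> c x y; apply: (tW_linear hM); exact: vnP.
- by move=> x; apply: (tW_positive hM); exact: vnP.
- move=> x x0.
  have vx : val x = 0.
    apply: (tW_faithful hM (vnP x)); move: x0.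
    by rewrite /vn_tau vn_valM vn_starE.
  apply: val_inj; rewrite vx.
  by rewrite raddf0.
- by move=> x y; apply: (tW_tracial hM); exact: vnP.
- exact: (tW_unital hM).
move=> b; have [k k_gt0 bk] := operator_bound_exists (val (vn_star b * b)).
exists k => // x; have [L L_gt0 tauL] := tau_norm_bounded hM.
have [l l_gt0 xl] := operator_bound_exists (val x); have [m m_gt0 xm] := operator_bound_exists (val (vn_star x)).
exists (L * (m * l)) => n.
pose h := vn_star b * b.
have hn u : rdot (val (h ^+ n) u) (val (h ^+ n) u) <= (k ^+ n) ^+ 2 * rdot u u.
  elim: n u => [|n IHn] u; first by rewrite expr0 expr1n mul1r.
  rewrite [h ^+ _]exprS [k ^+ n.+1]exprS; exact: (operator_bound_mul bk IHn).
have := tauL (val (vn_star x * h ^+ n * x)) (m * k ^+ n * l) (vnP _).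
rewrite !mulr_gt0 ?exprn_gt0 // => /(_ isT) tl.
rewrite (_ : L * (m * l) * k ^+ n = L * (m * k ^+ n * l)); last by ring.
rewrite -lecR; apply: le_trans (tl _).
  by apply: le_trans (normc_ge_Re _); rewrite lecR ler_norm.
exact: (operator_bound_mul (operator_bound_mul xm hn) xl).
Qed.

End TracialInstance.

Section WstarSubalgebra.
Context (R : realType) (H : hilbertType R) (M : set (bop H)) (tau : bop H -> R[i]).
Variables (X : bop H) (B : subalgClosed (bop H)).
Hypothesis hM : tracial_Wstar_probability_space M tau.
Hypothesis MX : M X.
Hypothesis X_sa : adjoint X = X.
Hypothesis MB : forall b : bop H, b \in B -> M b.
Hypothesis B_star : forall b : bop H, b \in B -> adjoint b \in B.
Local Notation C := (R[i]).

Lemma adjoin_sub_vn (a : subalg (adjoin B X)) : M (val a).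
Proof. by apply: (von_neumann_adjoin (tW_von_neumann hM) MX MB); exact: valP. Qed.
Definition to_vn (a : subalg (adjoin B X)) : vn_type M := vn hM (adjoin_sub_vn a).
Lemma to_vnE a : val (to_vn a) = val a. Proof. exact: SubK. Qed.
Fact to_vn_linear : linear to_vn.
Proof. by move=> c a b; apply: val_inj. Qed.
HB.instance Definition _ := GRing.isLinear.Build C (subalg (adjoin B X)) (vn_type M) *:%R
  to_vn to_vn_linear.
Fact to_vn_monoid : monoid_morphism to_vn.
Proof. by split=> [|a b]; apply: val_inj. Qed.
HB.instance Definition _ := GRing.isMonoidMorphism.Build (subalg (adjoin B X)) (vn_type M)
  to_vn to_vn_monoid.

Local Notation nsqM := (@tau_nsq R (vn_type M : algType C) (vn_star hM) (@vn_tau R H M tau)).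

Lemma Wstar_sub : Wstar X B `<=` M.
Proof. by move=> T /(_ M (tW_von_neumann hM) MX MB). Qed.

Lemma Wstar_norm2_density T (e : R) : Wstar X B T -> 0 < e ->
  forall TM : M T, exists a, nsqM (vn hM TM - to_vn a) < e.
Proof.
move=> TW e_gt0 TM.
pose A := [set a | a \in adjoin B X].
have [] := @norm2_density _ _ _ _ hM A (rpred1 _) _ _ _ (adjoin_adjoint X_sa B_star) _ T e TM _ e_gt0.
- by move=> a b aA bA; exact: rpredD.
- by move=> c a aA; exact: rpredZ.
- by move=> a b aA bA; exact: rpredM.
- move=> a S aA MS; pose x := vn hM MS - to_vn (Sub a aA).
  exact: (vnP hM (vn_star hM x * x)).
- by move: TW; rewrite (Wstar_double_commutant X_sa B_star).
move=> a aA aT; exists (Sub a aA).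
rewrite -ltcR; apply: le_lt_trans aT.
set x := vn hM TM - _.
have -> : adjoint (T - a) * (T - a) = adjoint (val x) * val x by [].
rewrite -(vn_starE hM) -vn_valM -/(vn_tau _).
apply: le_trans (normc_ge_Re _); rewrite lecR; exact: ler_norm.
Qed.

Lemma norm2_val (x : vn_type M) : norm2 tau (val x) ^+ 2 = nsqM x.
Proof.
have -> : norm2 tau (val x) = Num.sqrt (nsqM x).
  by rewrite /norm2 /tau_nsq /tau_rip /tau_ip /vn_tau vn_valM vn_starE.
by rewrite sqr_sqrtr // (nsq_ge0 (vn_tracial hM)).
Qed.

(** Cauchy-Schwarz for the terms of a Cauchy sequence xi, which are bounded in
    the norm of the trace. *)
Lemma conjugate_bound xi : conjugate_variable tau X B xi -> exists K : R, forall a,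
  normsq (tau_tau tau (free_difference_quotient (B := B) (X := X) a)) <= K * nsqM (to_vn a).
Proof.
move=> [[xiN xi_cauchy] xi_lim].
have [k kP] := xi_cauchy 1 ltr01.
have Mxi n : M (xi n) by exact: Wstar_sub.
pose x n := vn hM (Mxi n).
pose K : R := 2 + 2 * nsqM (x k).
have xK n : (k <= n)%N -> nsqM (x n) <= K.
  move=> kn; rewrite -[x n](subrK (x k)).
  apply: le_trans (nsqD (vn_tracial hM) _ _) _; rewrite lerD2r.
  have xx : norm2 tau (val (x n - x k)) < 1 by exact: kP.
  rewrite -norm2_val -[leRHS]mulr1 ler_pM2l //.
  by apply: exprn_ile1; [exact: sqrtr_ge0|exact: ltW].
exists (2 * K) => a; apply/ler_addgt0Pr => e e_gt0.
pose t : R := Num.sqrt (e / 2).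
have t_gt0 : 0 < t by rewrite sqrtr_gt0 divr_gt0.
have := xi_lim a => /cvgrPdist_lt /(_ t%:C).
rewrite ltcR => /(_ t_gt0) [n0 _ n0P].
pose n := maxn k n0.
have kn : (k <= n)%N by exact: leq_maxl.
have /= := n0P n (leq_maxr _ _); set L := tau_tau tau _; set s := tau (xi n * val a) => Ls.
have sK : normsq s <= K * nsqM (to_vn a).
  apply: le_trans (trace_CS (vn_tracial hM) (x n) (to_vn a)) _.
  by rewrite ler_wpM2r ?xK // (nsq_ge0 (vn_tracial hM)).
have Ls2 : normsq (L - s) <= e / 2.
  have <- : t ^+ 2 = e / 2 by rewrite sqr_sqrtr // ltW // divr_gt0.
  rewrite -lecR -normsqE rmorphXn /= ler_pXn2r ?nnegrE ?normr_ge0 ?ler0c ?(ltW t_gt0) //.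
  exact: ltW Ls.
rewrite -[L](subrK s); apply: le_trans (normsqD _ _) _.
move: Ls2 sK; move: (normsq (L - s)) (normsq s) (nsqM (to_vn a)) (K) => u v w c.
by lra.
Qed.

End WstarSubalgebra.

Theorem theorem4 (R : realType) (H : hilbertType R) (M : set (bop H))
    (tau : bop H -> R[i]) (X : bop H) (B : subalgClosed (bop H))
    (hM : tracial_Wstar_probability_space M tau)
    (MX : M X) (X_sa : adjoint X = X)
    (MB : forall b : bop H, b \in B -> M b)
    (B_star : forall b : bop H, b \in B -> adjoint b \in B)
    (B_free : algebraically_free B X)
    (B_diffuse : exists2 b : bop H, b \in B & adjoint b = b /\ diffuse tau b)
    (Phi_fin : (free_fisher_information tau X B < +oo)%E) :
  is_factor (Wstar X B).
Proof.
have W_vn : von_neumann_algebra (Wstar X B).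
  rewrite (Wstar_double_commutant X_sa B_star).
  exact: double_commutant_von_neumann (adjoin_adjoint X_sa B_star).
split=> // Z WZ Z_central.
have MZ : M Z by exact: (Wstar_sub hM MX MB WZ).
have [b bB [b_sa [mu [[[r mu_r] mu_tau] mu_diffuse]]]] := B_diffuse.
have [xi xiP] : exists xi, conjugate_variable tau X B xi.
  apply: contrapT => no; move: Phi_fin; rewrite /free_fisher_information.
  by case: asboolP => // _; rewrite ltxx.
have [K K_bound] := conjugate_bound hM MX MB xiP.
have [d_linear d_leibniz dX dB] := free_difference_quotientP B_free.
pose A := subalg (adjoin B X).
pose x : A := Sub X (mem_adjoin B X).
pose bA : A := Sub b (subset_adjoin X bB).
have WA (a : A) : Wstar X B (val a).
  by apply: (von_neumann_adjoin W_vn); [move=> N _|move=> c cB N _ _|exact: valP] => //; exact.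
have WZs : Wstar X B (adjoint Z) by exact: W_vn.1.
have Z_scalar : vn hM MZ = (vn_tau tau (vn hM MZ))%:A.
  apply: (@central_scalar R (vn_type M) (vn_star hM) (@vn_tau R H M tau) (vn_tracial hM)
    A (to_vn hM MX MB) _ d_linear d_leibniz K _ bA _ _ mu r mu_r mu_diffuse _
    (vn hM MZ) _ x _ _ _).
  - move=> a; have := K_bound a; congr (normsq _ <= _).
    apply: eq_bigr => i _.
    by rewrite mul1r mulr1.
  - by apply: val_inj; exact: b_sa.
  - by apply: dB; exact: bB.
  - by move=> n; rewrite -mu_tau /vn_tau vn_valX to_vnE.
  - by move=> a; apply: val_inj; exact: (Z_central _ (WA a)).
  - exact: dX.
  - by move=> e e_gt0; exact: Wstar_norm2_density.
  - move=> e e_gt0; exact: (Wstar_norm2_density hM MX X_sa MB B_star WZs e_gt0 (vn_star_subproof hM (vn hM MZ))).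
by exists (tau Z); have := congr1 val Z_scalar.
Qed.
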